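(* Let $M$ be a set of probability measures on $(0,\infty)$ such that: $M$, treated as a set of measures on $\mathbb{R}$, is weakly compact; $\operatorname{Span}(\mu)=0$ for all $\mu\in M$; and $M$ is uniformly integrable, that is, $\lim_{a\to+\infty}\sup_{\mu\in M}\int_{[a,\infty)}t\,\mu(\mathrm{d}t)=0$. Let $H$ be a uniformly directly Riemann integrable set of functions $[0,\infty)\to\mathbb{R}$. Then \[ (U_\mu*h)(t)\to\lambda_\mu\int_0^\infty h(s)\,\mathrm{d}s\quad\text{as }t\to\infty, \] uniformly in $\mu\in M$ and $h\in H$.
   Context: For a probability measure $\mu$ on $(0,\infty)$: - $\operatorname{Span}(\mu)=\max\bigl(\{\delta>0:\mu(\{\delta,2\delta,3\delta,\dots\})=1\}\cup\{0\}\bigr)$; so $\operatorname{Span}(\mu)=0$ means $\mu$ is nonlattice. - The renewal measure is $U_\mu=\sum_{n=0}^\infty\mu^{*n}$, where $\mu^{*n}$ is the $n$-fold convolution of $\mu$ with itself and $\mu^{*0}$ is the unit atom at $0$; it is a locally finite measure on $[0,\infty)$. - $\lambda_\mu=1/\int t\,\mu(\mathrm{d}t)$. ''Weakly compact'' refers to the topology of weak convergence of probability measures on $\mathbb{R}$. The convolution is $(U_\mu*h)(t)=\int_{[0,t]}h(t-s)\,U_\mu(\mathrm{d}s)$; functions $h$ are tacitly Borel measurable, so that this integral makes sense. A set $H$ of functions $[0,\infty)\to\mathbb{R}$ is uniformly directly Riemann integrable if (i) $\sup_{h\in H}\sum_{n=0}^\infty\sup_{[n,n+1)}|h(\cdot)|<\infty$;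 (ii) $\sum_{n=N}^\infty\sup_{[n,n+1)}|h(\cdot)|\to0$ as $N\to\infty$, uniformly in $h\in H$; (iii) $\delta\sum_{n=0}^\infty\bigl(\sup_{[n\delta,n\delta+\delta)}h(\cdot)-\inf_{[n\delta,n\delta+\delta)}h(\cdot)\bigr)\to0$ as $\delta\to0+$, uniformly in $h\in H$. *)

(* Defs.v *)
From HB Require Import structures.
From mathcomp Require Import all_boot all_order all_algebra.
From mathcomp Require Import all_classical all_reals all_analysis.

Set Implicit Arguments.
Unset Strict Implicit.
Unset Printing Implicit Defensive.

Import Order.TTheory GRing.Theory Num.Theory.
Import numFieldNormedType.Exports.

Local Open Scope classical_set_scope.
Local Open Scope ring_scope.

Notation realProbability R := (probability (measurableTypeR R) R).

(* A measure on (0, +oo) is treated as a measure on the real line that gives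
   full mass to (0, +oo). *)
Definition on_positive (R : realType) (mu : realProbability R) : Prop :=
  mu `]0, +oo[%classic = 1%E.

Definition bounded_continuous (R : realType) : Type :=
  {f : R -> R | continuous f /\ bounded_fun f}.

HB.instance Definition _ (R : realType) := gen_eqMixin (bounded_continuous R).
HB.instance Definition _ (R : realType) :=
  gen_choiceMixin (bounded_continuous R).

Definition weak_eval (R : realType) (mu : realProbability R) :
    {ptws (bounded_continuous R) -> R} :=
  fun f => \int[mu]_x (sval f x).

(* The topology of weak convergence: the coarsest one that makes
   [mu |-> \int f dmu] continuous for every bounded continuous [f]. *)
Definition weak_probability (R : realType) : topologicalType :=
  initial_topology (@weak_eval R).

Definition weakly_compact (R : realType) (M : set (realProbability R)) : Prop :=
  compact (M : set (weak_probability R)).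

Definition lattice_steps (R : realType) (mu : realProbability R) : set R :=
  [set d | 0 < d /\ mu [set k.+1%:R * d | k in [set: nat]] = 1%E].

Definition Span (R : realType) (mu : realProbability R) : R :=
  let D := lattice_steps mu `|` [set 0] in xget 0 (D `&` ubound D).

(* The maximum defining [Span] always exists, so that the default value of
   [xget] is never used. *)
Lemma Span_max (R : realType) (mu : realProbability R) :
  let D := lattice_steps mu `|` [set 0] in D (Span mu) /\ ubound D (Span mu).
Proof.
move=> D; rewrite /Span -/D.
suff : exists m, (D `&` ubound D) m by move=> /(xgetPex 0).
have [[d0 d0D]|noD] := pselect (exists d, lattice_steps mu d); last first.
  exists 0; split; first by right.
  by move=> d [dD|->//]; exfalso; apply: noD; exists d.
have m1 (x : R) : measurable ([set x] : set (measurableTypeR R)).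
  exact: measurable_set1.
have mN (d : R) :
    measurable ([set k.+1%:R * d | k in [set: nat]] : set (measurableTypeR R)).
  by rewrite -bigcup_imset1; exact: bigcup_measurable.
have [x xmu] : exists x : R, mu [set x] != 0%E.
  apply: contrapT => /forallNP h.
  have [_ mu1] := d0D.
  suff : mu.-negligible [set k.+1%:R * d0 | k in [set: nat]].
    move=> /(negligibleP mu (mN d0)) mu0.
    by have /eqP := etrans (esym mu1) mu0; rewrite onee_eq0.
  rewrite -bigcup_imset1.
  apply: negligible_bigcup => k; apply/negligibleP => //.
  by apply/eqP/negPn/negP; exact: h.
have xstep d : lattice_steps mu d -> exists k : nat, d = x / k.+1%:R.
  move=> [d_gt0 mud]; apply: contrapT => /forallNP h.
  move/negP: xmu; apply; rewrite -measure_le0.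
  have := @probability_setC _ _ _ mu _ (mN d).
  rewrite mud subee// => <-; apply: le_measure; rewrite ?inE//.
    exact: measurableC.
  move=> _ -> [k _ kdx]; apply: (h k).
  by rewrite -kdx mulrAC divff ?mul1r// pnatr_eq0.
have [k0 k0D] := xstep _ d0D.
have exk : exists k, `[< lattice_steps mu (x / k.+1%:R) >].
  by exists k0; apply/asboolP; rewrite -k0D.
case: (ex_minnP exk) => k /asboolP kD kmin.
have x_gt0 : 0 < x.
  by have := kD.1; rewrite pmulr_lgt0// invr_gt0 ltr0n.
exists (x / k.+1%:R); split; first by left.
move=> d [dD|->]; last exact: ltW kD.1.
have [l ldx] := xstep _ dD.
rewrite ldx ler_pM2l// lef_pV2 ?posrE ?ltr0n// ler_nat ltnS kmin//.
by apply/asboolP; rewrite -ldx.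
Qed.

Section convolution.
Context (R : realType).

Definition add_pair (x : measurableTypeR R * measurableTypeR R) :
  measurableTypeR R := x.1 + x.2.

Lemma measurable_add_pair : measurable_fun [set: _] add_pair.
Proof. by apply: measurable_realfun.measurable_funD. Qed.

HB.instance Definition _ :=
  isMeasurableFun.Build _ _ _ _ add_pair measurable_add_pair.

Definition convolution (mu nu : realProbability R) : realProbability R :=
  distribution (mu \x nu)%E add_pair.

Fixpoint convolution_power (mu : realProbability R) (n : nat) :
    realProbability R :=
  if n is m.+1 then convolution mu (convolution_power mu m)
  else \d_(0 : measurableTypeR R).

Definition renewal_measure (mu : realProbability R) :
    {measure set (measurableTypeR R) -> \bar R} :=
  mseries (fun n => convolution_power mu n) 0.

End convolution.

(* [Rintegral] is 0 when the integrand is not integrable; this does not happen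
   for [h] measurable and directly Riemann integrable, since such [h] is bounded
   and the renewal measure is locally finite. *)
Definition renewal_convolution (R : realType) (mu : realProbability R)
    (h : R -> R) (t : R) : R :=
  \int[renewal_measure mu]_(s in `[0, t]) h (t - s).

Definition renewal_rate (R : realType) (mu : realProbability R) : R :=
  (\int[mu]_(t in `]0, +oo[) t)^-1.

Definition uniformly_integrable (R : realType) (M : set (realProbability R)) :
    Prop :=
  ereal_sup [set (\int[mu]_(t in `[a, +oo[) t%:E)%E | mu in M] @[a --> +oo]
    --> 0%E.

Definition esup_on (R : realType) (A : set R) (f : R -> R) : \bar R :=
  ereal_sup [set (f x)%:E | x in A].

Definition einf_on (R : realType) (A : set R) (f : R -> R) : \bar R :=
  ereal_inf [set (f x)%:E | x in A].

(* A function on [0, +oo) is represented by a function on the real line whose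
   values on the negative half-line are never used. *)
Definition uniformly_dRi (R : realType) (H : set (R -> R)) : Prop :=
  [/\ (ereal_sup
        [set (\sum_(0 <= n <oo)
               esup_on `[n%:R, n.+1%:R[ (fun x => `|h x|%R))%E | h in H]
        < +oo)%E,
      forall e : R, 0 < e -> \forall N \near \oo, forall h, H h ->
        (\sum_(N <= n <oo) esup_on `[n%:R, n.+1%:R[ (fun x => `|h x|%R)
           < e%:E)%E
    & forall e : R, 0 < e -> \forall d \near 0^'+, forall h, H h ->
        (d%:E * \sum_(0 <= n <oo)
           (esup_on `[(n%:R * d)%R, (n%:R * d + d)%R[ h
            - einf_on `[(n%:R * d)%R, (n%:R * d + d)%R[ h)
         < e%:E)%E].

(* Main.v *)
Require Import Defs.
From mathcomp Require Import all_boot all_order all_algebra.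
From mathcomp Require Import all_classical all_reals all_analysis.
From mathcomp Require Import measurable_realfun ring lra.

(** Let [X] have law [mu] and let [U] be the renewal measure of [mu]. The
    convolution [U * f] is the least nonnegative solution of the renewal
    equation [u = f + mu * u], so that it lies below every nonnegative
    supersolution ([renewal_supersolution]). Clamped affine functions are
    supersolutions for indicators of intervals, up to the factor [E min(X,
    1)], which weak compactness bounds below on [M]. Hence [U] is locally
    bounded, uniformly in [mu] and in the position of the interval
    ([renewal_conv_bound]).

    Let [v = U * clamp d] ([smoothed]), with [clamp d y] the projection of
    [y] on [[0, d]]. For large [t] its increments [u t = v t - v (t - eta)]
    are bounded, Lipschitz and harmonic: [u t] is the mean of [u (t - X)].
    The heart of the proof is that such functions vary slowly, [u t - u (t -
    h) -> 0], uniformly on [M] ([slow_variation]). By compactness it suffices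
    to let [mu] tend to some [mu0] and [t] to infinity together. Take [h] in
    the support of [mu0], and suppose that the upper limit [S] of [psi t = u
    t - u (t - h)] is positive. Where [psi] is almost [S], averaging forces
    [psi (t - h)] to be almost [S] too, because measures close to [mu0]
    charge every neighbourhood of [h]; so [psi] is almost [S] at [t], [t -
    h], [t - 2 h] and so on, and the sum of these values is an increment of
    [u], which is bounded: a contradiction. The good shifts [h] form a closed
    subgroup of the line; as [Span mu0 = 0], a closed subgroup that contains
    the support of [mu0] is the whole line ([nonlattice_closed_subgroup]).

    By slow variation, [v] is almost affine near a large [t], and its slope
    is read off from the exact identity [E (v t - v (t - X)) = d]
    ([smoothed_drift]); uniform integrability takes care of the long steps.
    The slope is therefore close to [d / E X] ([smoothed_slope]). Comparing
    indicators of intervals with trapezoids turns this into the uniform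
    Blackwell theorem ([blackwell]), and comparing [h] with step functions,
    on which direct Riemann integrability gives uniform control, yields the
    result ([key_renewal_estimate]). *)

Import Order.TTheory GRing.Theory Num.Theory.
Import numFieldNormedType.Exports.

Set Implicit Arguments.
Unset Strict Implicit.
Unset Printing Implicit Defensive.

Local Open Scope classical_set_scope.
Local Open Scope ring_scope.

(** * The renewal equation *)

Section renewal_equation.
Context (R : realType).
Implicit Types (mu nu : realProbability R) (f g : R -> R) (t : R).

(** The convolution of [f] with the renewal measure over the whole line; with
   extended real values it can be handled before anything is known to be
   finite. *)
Definition renewal_conv mu f t : \bar R :=
  \int[renewal_measure mu]_s (f (t - s))%:E.

Definition power_conv mu n f t : \bar R :=
  \int[convolution_power mu n]_s (f (t - s))%:E.

Lemma measurable_fun_reflect f t :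
  measurable_fun [set: measurableTypeR R] (f : _ -> measurableTypeR R) ->
  measurable_fun [set: measurableTypeR R]
    ((fun s => f (t - s)) : _ -> measurableTypeR R).
Proof.
move=> mf; apply: (measurableT_comp mf).
exact: measurable_funB.
Qed.

Lemma power_convS mu n f t : (forall x, 0 <= f x) ->
  measurable_fun [set: measurableTypeR R] (f : _ -> measurableTypeR R) ->
  power_conv mu n.+1 f t = (\int[mu]_x power_conv mu n f (t - x))%E.
Proof.
move=> f0 mf; rewrite /power_conv /=.
rewrite (ge0_integral_pushforward (@measurable_add_pair R))//; last 2 first.
- by apply/measurable_EFinP; exact: measurable_fun_reflect.
- by move=> y _; rewrite lee_fin.
pose F (z : measurableTypeR R * measurableTypeR R) :=
  (f (t - Defs.add_pair z))%:E.
have mF : measurable_fun setT F.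
  apply/measurable_EFinP.
  exact: (measurableT_comp (measurable_fun_reflect t mf)
            (@measurable_add_pair R)).
have F0 z : (0 <= F z)%E by rewrite lee_fin.
have tonelli := @fubini_tonelli1 _ _ _ _ R mu (convolution_power mu n) F mF F0.
apply: (etrans tonelli).
apply: eq_integral => x _; apply: eq_integral => y _.
by rewrite /F /Defs.add_pair opprD addrA.
Qed.

Lemma measurable_power_conv mu n f t : (forall x, 0 <= f x) ->
  measurable_fun [set: measurableTypeR R] (f : _ -> measurableTypeR R) ->
  measurable_fun [set: measurableTypeR R] (fun x => power_conv mu n f (t - x)).
Proof.
move=> f0 mf.
pose F (z : measurableTypeR R * measurableTypeR R) := (f (t - z.1 - z.2))%:E.
apply: (measurable_fun_fubini_tonelli_F F) => [|z]; last by rewrite lee_fin.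
apply/measurable_EFinP; apply: (measurableT_comp mf).
by apply: measurable_funB => //; exact: measurable_realfun.measurable_funB.
Qed.

Lemma power_conv_ge0 mu n f t : (forall x, 0 <= f x) ->
  (0 <= power_conv mu n f t)%E.
Proof. by move=> f0; apply: integral_ge0 => x _; rewrite lee_fin. Qed.

Lemma power_conv0 mu f t :
  measurable_fun [set: measurableTypeR R] (f : _ -> measurableTypeR R) ->
  power_conv mu 0 f t = (f t)%:E.
Proof.
move=> mf; rewrite /power_conv/= integral_dirac//.
  by rewrite diracT mul1e subr0.
by apply/measurable_EFinP; exact: measurable_fun_reflect.
Qed.

Lemma renewal_convE mu f t : (forall x, 0 <= f x) ->
  measurable_fun [set: measurableTypeR R] (f : _ -> measurableTypeR R) ->
  renewal_conv mu f t = (\sum_(n <oo) power_conv mu n f t)%E.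
Proof.
move=> f0 mf; rewrite /renewal_conv ge0_integral_measure_series//.
- by move=> s _; rewrite lee_fin.
- by apply/measurable_EFinP; exact: measurable_fun_reflect.
Qed.

(** Conditioning on the first step of the walk: splitting off the term [n = 0]
    of the series leaves one extra convolution with [mu]. *)
Lemma renewal_equation mu f t : (forall x, 0 <= f x) ->
  measurable_fun [set: measurableTypeR R] (f : _ -> measurableTypeR R) ->
  renewal_conv mu f t = ((f t)%:E + \int[mu]_x renewal_conv mu f (t - x))%E.
Proof.
move=> f0 mf; rewrite renewal_convE// nneseries_recl//; last first.
  by move=> n _; exact: power_conv_ge0.
rewrite power_conv0//; congr (_ + _)%E.
under [RHS]eq_integral do rewrite renewal_convE//.
rewrite integral_nneseries//; last 2 first.
- by move=> n; exact: measurable_power_conv.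
- by move=> n x _; exact: power_conv_ge0.
rewrite -(nneseries_addn (f := fun n => power_conv mu n f t) 1)//.
  by apply: eq_eseriesr => n _; rewrite addn1 power_convS.
by move=> n; exact: power_conv_ge0.
Qed.

End renewal_equation.

(** * Expectations under a measure on the positive half-line *)

Section continuous_functions.
Context (R : realType).
Implicit Type t : R.

Lemma continuous_measurableR (f : R -> R) : continuous f ->
  measurable_fun [set: measurableTypeR R] (f : _ -> measurableTypeR R).
Proof. exact: continuous_measurable_fun. Qed.

Lemma lipschitz_continuous (f : R -> R) (L : R) :
  (forall s t, `|f s - f t| <= L * `|s - t|) -> continuous f.
Proof.
move=> Lf x; apply/cvgrPdist_lt => e e0.
have L0 : 0 < `|L| + 1 by rewrite ltr_pwDr.
near=> y.
apply: le_lt_trans (Lf _ _) _.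
apply: (@le_lt_trans _ _ ((`|L| + 1) * `|x - y|)).
  by rewrite ler_wpM2r// (le_trans (ler_norm L))// lerDl.
rewrite mulrC -ltr_pdivlMr//.
near: y; apply: cvgr_dist_lt; [exact: cvg_id|exact: divr_gt0].
Unshelve. all: by end_near. Qed.

Lemma continuous_reflect (f : R -> R) t : continuous f ->
  continuous (fun x => f (t - x)).
Proof.
move=> cf x; apply: (continuous_comp (f := fun x => t - x)); last exact: cf.
by apply: continuousB; [exact: cvg_cst|exact: cvg_id].
Qed.

End continuous_functions.

Section positive_probability.
Context (R : realType) (mu : realProbability R).
Hypothesis mu_positive : on_positive mu.

Lemma measurable_positive :
  measurable (`]0, +oo[%classic : set (measurableTypeR R)).
Proof. exact: measurable_itv. Qed.

Lemma nonpositive_null : mu (~` `]0, +oo[%classic) = 0%E.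
Proof.
have := @probability_setC _ _ _ mu _ measurable_positive.
by rewrite mu_positive subee.
Qed.

(** Under a measure carried by the positive half-line, integrands need only be
    compared at positive points. *)
Lemma le_integral_positive (f g : measurableTypeR R -> \bar R) :
  measurable_fun setT f -> measurable_fun setT g ->
  (forall x, 0 <= f x)%E -> (forall x, 0 <= g x)%E ->
  (forall x : R, 0 < x -> (f x <= g x)%E) ->
  (\int[mu]_x f x <= \int[mu]_x g x)%E.
Proof.
move=> mf mg f0 g0 fg; apply: ae_ge0_le_integral => //.
exists (~` `]0, +oo[%classic); split.
- by apply: measurableC; exact: measurable_positive.
- exact: nonpositive_null.
- move=> x /= nfg; rewrite in_itv/= andbT => x0; apply: nfg => _.
  exact: fg.
Qed.

Lemma Rintegral_positive (f : measurableTypeR R -> R) :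
  mu.-integrable setT (EFin \o f) ->
  \int[mu]_x f x = \int[mu]_(x in `]0, +oo[) f x.
Proof.
move=> intf; rewrite /Rintegral.
rewrite (@negligible_integral _ _ _ mu _ (~` `]0, +oo[%classic))//.
- by rewrite setTD setCK.
- by apply: measurableC; exact: measurable_positive.
- exact: nonpositive_null.
Qed.

Lemma le_Rintegral_positive (f g : measurableTypeR R -> R) :
  mu.-integrable setT (EFin \o f) -> mu.-integrable setT (EFin \o g) ->
  (forall x : R, 0 < x -> f x <= g x) ->
  \int[mu]_x f x <= \int[mu]_x g x.
Proof.
move=> intf intg fg; rewrite !Rintegral_positive//.
apply: le_Rintegral => //.
- exact: integrableS intf.
- exact: integrableS intg.
- by move=> x; rewrite /= in_itv/= andbT; exact: fg.
Qed.

Lemma integrable_bounded (f : measurableTypeR R -> R) (C : R) :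
  measurable_fun setT (f : _ -> measurableTypeR R) ->
  (forall x, `|f x| <= C) -> mu.-integrable setT (EFin \o f).
Proof.
move=> mf fC; apply: measurable_bounded_integrable => //.
  by rewrite [X in (X < _)%E](@probability_setT _ _ _ mu) ltry.
by exists C; split; [exact: num_real|move=> y Cy x _; exact: le_trans (ltW Cy)].
Qed.

Lemma integrable_cstR (c : R) :
  mu.-integrable setT (EFin \o (fun=> c : R)).
Proof. exact: (@integrable_bounded _ `|c|). Qed.

Lemma integrable_addR (f g : measurableTypeR R -> R) :
  mu.-integrable setT (EFin \o f) -> mu.-integrable setT (EFin \o g) ->
  mu.-integrable setT (EFin \o (fun x => f x + g x)).
Proof. by move=> intf intg; exact: (integrableD measurableT intf intg). Qed.

Lemma integrable_scaleR (c : R) (f : measurableTypeR R -> R) :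
  mu.-integrable setT (EFin \o f) ->
  mu.-integrable setT (EFin \o (fun x => c * f x)).
Proof. by move=> intf; exact: (integrableZl measurableT c intf). Qed.

Lemma integrable_subR (f g : measurableTypeR R -> R) :
  mu.-integrable setT (EFin \o f) -> mu.-integrable setT (EFin \o g) ->
  mu.-integrable setT (EFin \o (fun x => f x - g x)).
Proof. by move=> intf intg; exact: (integrableB measurableT intf intg). Qed.

Lemma Rintegral_probability_cst (c : R) : \int[mu]_x c = c.
Proof. 
rewrite Rintegral_cst// [X in _ * fine X](@probability_setT _ _ _ mu).
by rewrite mulr1. Qed.

Lemma Rintegral_gt0 (f : measurableTypeR R -> R) (A : set (measurableTypeR R)) :
  measurable A -> mu A != 0%E ->
  mu.-integrable setT (EFin \o f) -> (forall x, 0 <= f x) ->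
  (forall x, A x -> 0 < f x) -> 0 < \int[mu]_x f x.
Proof.
move=> mA muA intf f0 fA; rewrite lt_neqAle Rintegral_ge0// andbT.
apply/negP => /eqP int0; move/negP: muA; apply; apply/eqP.
have ae0 : ae_eq mu setT (EFin \o f) (cst 0%E).
  apply/ae_eq_integral_abs => //; first exact: measurable_int intf.
  under eq_integral => x _ do rewrite /= ger0_norm//.
  rewrite -[LHS]fineK; last exact: integrable_fin_num.
  by congr EFin; exact: esym int0.
apply: (negligibleP mu mA).1; apply: negligibleS ae0 => x Ax /= fx0.
by have := fA _ Ax; have [->] := fx0 I; rewrite ltxx.
Qed.

End positive_probability.

Section weak_neighbourhoods.
Context (R : realType).

Lemma weak_eval_continuous (f : R -> R) : continuous f -> bounded_fun f ->
  continuous ((fun mu => \int[mu]_x f x) : weak_probability R -> R).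
Proof.
move=> cf bf.
pose F : bounded_continuous R := exist _ f (conj cf bf).
have c1 : continuous (@weak_eval R : weak_probability R -> _).
  exact: initial_continuous.
have c2 : continuous (fun h : {ptws (bounded_continuous R) -> R} => h F).
  exact: (@proj_continuous _ (fun=> R) F).
by move=> mu; exact: (@continuous_comp (weak_probability R) _ _
  (@weak_eval R) (fun h => h F) mu (c1 mu) (c2 _)).
Qed.

End weak_neighbourhoods.

(** * Bounds that hold uniformly on [M] *)

Section uniform_bounds.
Context (R : realType) (M : set (realProbability R)).

(** The form in which weak compactness is used: it turns estimates near each
    measure of [M] into estimates that are uniform on [M]. *)
Lemma compact_eventually (I : Type) (F : set_system I) (FF : Filter F)
    (P : I -> realProbability R -> Prop) : weakly_compact M ->
  (forall mu0, M mu0 ->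
    \forall mu \near (mu0 : weak_probability R) & i \near F, M mu -> P i mu) ->
  \forall i \near F, forall mu, M mu -> P i mu.
Proof.
move=> /compact_near_coveringP/near_covering_withinP cM PM.
exact: (cM I F P FF PM).
Qed.

(** [E min(X, 1)]: the integrand is bounded and continuous, so that this is a
    weakly continuous substitute for the mean. *)
Definition truncated_mean (mu : realProbability R) : R :=
  \int[mu]_x Num.min `|x| 1.

Lemma continuous_truncation : continuous (fun x : R => Num.min `|x| 1).
Proof.
move=> x; apply: (@continuous_min _ _ (fun x : R => `|x|) (fun=> 1)).
  exact: norm_continuous.
exact: cvg_cst.
Qed.

Lemma truncation_bound (x : R) : `|Num.min `|x| 1| <= 1.
Proof. by rewrite ger0_norm ?ge_min ?lexx ?orbT// le_min normr_ge0/=. Qed.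

Lemma integrable_truncation (mu : realProbability R) :
  mu.-integrable setT (EFin \o (fun x : measurableTypeR R => Num.min `|x| 1)).
Proof.
apply: (integrable_bounded _ (C := 1)) => [|x]; last exact: truncation_bound.
exact: (continuous_measurable_fun continuous_truncation).
Qed.

Lemma truncated_mean_gt0 (mu : realProbability R) : on_positive mu ->
  0 < truncated_mean mu.
Proof.
move=> mup; apply: (@Rintegral_gt0 _ _ _ `]0, +oo[%classic) => //.
- by rewrite mup onee_neq0.
- exact: integrable_truncation.
- move=> x /=; rewrite in_itv/= andbT => x0.
  by rewrite lt_min normr_gt0 gt_eqF//=.
Qed.

Hypothesis M_positive : forall mu, M mu -> on_positive mu.

Lemma truncated_mean_bounded_below : weakly_compact M ->
  exists2 m, 0 < m & forall mu, M mu -> m <= truncated_mean mu.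
Proof.
move=> M_compact.
have [m] : exists m : R, 0 < m /\ forall mu, M mu -> m < truncated_mean mu.
  apply: (@filter_ex _ (0^'+ : set_system R)).
  near=> m; split; first by near: m; exact: nbhs_right_gt.
  near: m; apply: compact_eventually => // mu0 Mmu0.
  have tm0 := truncated_mean_gt0 (M_positive Mmu0).
  have half_lt : truncated_mean mu0 / 2 < truncated_mean mu0 by lra.
  have tmc := @weak_eval_continuous R _ continuous_truncation.
  have bt : bounded_fun (fun x : R => Num.min `|x| 1).
    exists 1; split; first exact: num_real.
    by move=> y y1 x _; apply: le_trans (ltW y1); exact: truncation_bound.
  have N1 : \forall mu \near (mu0 : weak_probability R),
      truncated_mean mu0 / 2 < truncated_mean mu.
    exact: (tmc bt mu0 _ (lt_nbhsr half_lt)).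
  have N2 : \forall m \near 0^'+, m < truncated_mean mu0 / 2.
    by apply: nbhs_right_lt; lra.
  exists ([set mu : weak_probability R |
             truncated_mean mu0 / 2 < truncated_mean mu],
          [set m | m < truncated_mean mu0 / 2]) => //.
  by move=> [mu m'] [/= mu1 m1] _; exact: lt_trans m1 mu1.
by move=> [m0 mP]; exists m => // mu /mP/ltW.
Unshelve. all: by end_near. Qed.

(** Integrating [excess a] is integrating [x] over [a, +oo), and [excess a]
    dominates the indicator of that half-line as soon as [1 <= a]; one
    smallness condition thus controls both long steps and their probability. *)
Definition excess (a x : R) : R := if a <= x then x else 0.

Lemma excessE a (x : R) : excess a x = ((id : R -> R) \_ `[a, +oo[) x.
Proof. by rewrite /excess patchE mem_setE in_itv/= andbT. Qed.

Definition tail_small (mu : realProbability R) (a e : R) : Prop :=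
  (\int[mu]_x (excess a x)%:E < e%:E)%E.

Lemma uniformly_integrable_tail (e : R) : uniformly_integrable M -> 0 < e ->
  exists2 a, 1 <= a & forall mu, M mu -> tail_small mu a e.
Proof.
move=> ui e0.
have lte : \forall y \near 0%E, (y < e%:E :> \bar R)%E.
  apply: open_nbhs_nbhs; split; first exact: open_ereal_lt_ereal.
  by rewrite /= lte_fin.
have [a [a1 aP]] : exists a, 1 <= a /\
    (ereal_sup [set (\int[mu]_(t in `[a, +oo[) t%:E)%E | mu in M] < e%:E)%E.
  apply: (@filter_ex _ (+oo : set_system R)); apply: filterI.
    exact: nbhs_pinfty_ge.
  exact: ui lte.
exists a => // mu Mmu; rewrite /tail_small.
rewrite (_ : (\int[mu]_x _)%E = (\int[mu]_(t in `[a, +oo[) t%:E)%E).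
  by apply: le_lt_trans aP; apply: ereal_sup_ubound; exists mu.
rewrite [RHS]integral_mkcond; apply: eq_integral => x _.
by rewrite excessE restrict_EFin.
Qed.

End uniform_bounds.

Section excess.
Context (R : realType) (mu : realProbability R).

Lemma measurable_excess (a : R) :
  measurable_fun [set: measurableTypeR R] (excess a : _ -> measurableTypeR R).
Proof.
rewrite (_ : excess a = (id : R -> R) \_ `[a, +oo[); last first.
  by apply/funext => x; exact: excessE.
by apply/(measurable_restrictT _ _).1.
Qed.

Lemma excess_ge0 (a x : R) : 0 <= a -> 0 <= excess a x.
Proof. by move=> a0; rewrite /excess; case: ifPn => //; exact: le_trans. Qed.

Lemma le_add_excess (a x : R) : 0 <= a -> x <= a + excess a x.
Proof. by rewrite /excess; case: (leP a x) => ax a0; lra. Qed.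

Lemma integrable_excess a e : 0 <= a -> tail_small mu a e ->
  mu.-integrable setT (EFin \o excess a).
Proof.
move=> a0 tail; apply/integrableP; split.
  by apply/measurable_EFinP; exact: measurable_excess.
under eq_integral => x _ do rewrite /= ger0_norm ?excess_ge0//.
exact: lt_trans tail (ltry _).
Qed.

Lemma Rintegral_excess a e : 0 <= a -> tail_small mu a e ->
  \int[mu]_x excess a x <= e.
Proof.
move=> a0 tail; rewrite -lee_fin fineK; first exact: ltW.
exact/integrable_fin_num/(integrable_excess a0 tail).
Qed.

Lemma integrable_id a e : 0 <= a -> on_positive mu -> tail_small mu a e ->
  mu.-integrable setT (EFin \o (fun x : measurableTypeR R => `|x|)).
Proof.
move=> a0 mup tail; apply/integrableP; split.
  by apply/measurable_EFinP; exact: measurableT_comp.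
have int2 : mu.-integrable setT
    (EFin \o (fun x : measurableTypeR R => a + excess a x)).
  exact: (integrable_addR (integrable_cstR mu a) (integrable_excess a0 tail)).
have /integrableP[m2 lt2] := int2.
apply: le_lt_trans lt2; apply: le_integral_positive => //.
- apply: measurableT_comp => //; apply/measurable_EFinP.
  exact: measurableT_comp.
- by apply: measurableT_comp.
- move=> x x0; rewrite /= lee_fin normr_id [leRHS]ger0_norm; last first.
    by rewrite addr_ge0// excess_ge0.
  by rewrite gtr0_norm//; exact: le_add_excess.
Qed.

End excess.

(** * Support of a nonlattice measure *)

Section support.
Context (R : realType) (mu : realProbability R).

Definition in_support (h : R) : Prop :=
  forall d, 0 < d -> mu `]h - d, h + d[%classic != 0%E.

(** The complement of the support is covered by countably many null intervals
    with rational centres. *)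
Lemma closed_support_conull (P : set R) :
  (forall x, (forall e, 0 < e -> exists2 y, P y & `|x - y| < e) -> P x) ->
  in_support `<=` P ->
  mu.-negligible (~` P : set (measurableTypeR R)).
Proof.
move=> clP suppP.
pose B (k : nat) : set (measurableTypeR R) :=
  if unpickle k is Some (q, n) then
    let J : set R :=
      `](ratr q - n.+1%:R^-1 : R), (ratr q + n.+1%:R^-1 : R)[%classic in
    if mu J == 0%E then J else set0
  else set0.
have outP (x : R) : ~ P x -> (\bigcup_k B k) x.
  move=> nPx.
  have [d [d0 mud]] : exists d, 0 < d /\ mu `]x - d, x + d[%classic = 0%E.
    apply: contrapT => /forallNP H; apply/nPx/suppP => d d0.
    by apply/eqP => mud; apply: (H d).
  have [n nd] : exists n : nat, n.+1%:R^-1 < d / 2.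
    exists (Num.truncn (2 / d)); rewrite -ltf_pV2 ?posrE ?invr_gt0 ?divr_gt0//.
    by rewrite invrK invf_div truncnS_gt.
  have [r rE] : exists r : R, r = n.+1%:R^-1 by exists n.+1%:R^-1.
  have r0 : 0 < r by rewrite rE invr_gt0.
  have lt : x - r < x + r by lra.
  have [q] := rat_in_itvoo lt.
  rewrite in_itv/= => /andP[q1 q2].
  exists (pickle (q, n)); first exact: I.
  rewrite -rE in nd; rewrite /B pickleK/= -rE ifT.
    by rewrite /= in_itv/=; apply/andP; split; lra.
  apply/eqP; apply: subset_measure0 mud => //.
  by move=> y /=; rewrite !in_itv/= => /andP[y1 y2]; apply/andP; split; lra.
have : mu.-negligible (\bigcup_k B k).
  apply: negligible_bigcup => k; rewrite /B.
  case: (unpickle k : option (rat * nat)) => [[q n]|] /=; last first.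
    exact: negligible_set0.
  by case: eqP => [J0|_]; [exact/negligibleP|exact: negligible_set0].
by apply: negligibleS => x /= nPx; exact: outP.
Qed.

(** A closed subgroup of the line that is neither trivial nor everything
    consists of the multiples of its least positive element; a measure carried
    by it is then lattice. *)
Lemma nonlattice_closed_subgroup (P : set R) :
  on_positive mu -> Span mu = 0 ->
  P 0 -> (forall x y, P x -> P y -> P (x - y)) ->
  (forall x, (forall e, 0 < e -> exists2 y, P y & `|x - y| < e) -> P x) ->
  in_support `<=` P -> forall x, P x.
Proof.
move=> mup span0 P0 PB clP suppP.
have PN x : P x -> P (- x) by move=> Px; rewrite -sub0r; exact: PB.
have PD x y : P x -> P y -> P (x + y).
  by move=> Px Py; rewrite -[y]opprK; apply: PB => //; exact: PN.
have PMn x (n : nat) : P x -> P (n%:R * x).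
  move=> Px; elim: n => [|n IH]; first by rewrite mul0r.
  by rewrite -natr1 mulrDl mul1r; exact: PD.
have PMz x (n : int) : P x -> P (n%:~R * x).
  case: n => n Px; first by rewrite -pmulrn; exact: PMn.
  by rewrite NegzE mulrNz mulNr; apply: PN; rewrite -pmulrn; exact: PMn.
have conullP := closed_support_conull clP suppP.
have null_nonpos :
    mu.-negligible (~` `]0, +oo[%classic : set (measurableTypeR R)).
  apply/negligibleP; last exact: nonpositive_null.
  by apply: measurableC; exact: measurable_positive.
pose D := [set x | P x /\ 0 < x].
have D0 : D !=set0.
  apply: contrapT => noD.
  suff : mu.-negligible (setT : set (measurableTypeR R)).
    move/(negligibleP mu measurableT).
    rewrite [X in X = _](@probability_setT _ _ _ mu).
    by move/eqP; rewrite onee_eq0.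
  apply: negligibleS (negligibleU conullP null_nonpos) => x _ /=.
  apply/not_andP => -[Px]; rewrite in_itv/= andbT => x0.
  by apply: noD; exists x.
have infD : has_inf D by split => //; exists 0 => x [_ /ltW].
have [d0|d0] := leP (inf D) 0.
  move=> x; apply: clP => e e0.
  have [p [Pp p0] pe] := inf_adherent e0 infD.
  have {}pe : p < e by lra.
  exists ((Num.floor (x / p))%:~R * p); first exact: PMz.
  have /andP[f1 f2] := mem_rg1_floor (x / p).
  rewrite ger0_norm; last by rewrite subr_ge0 -ler_pdivlMr.
  move: f2; rewrite ltr_pdivrMr// mulrDl mul1r; lra.
exfalso; set d := inf D in d0.
have dD : D d.
  split => //; apply: clP => e e0.
  have [p [Pp p0] pe] := inf_adherent e0 infD.
  exists p => //.
  have : d <= p by apply: ge_inf => //; exact: infD.2.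
  by move=> dp; rewrite ler0_norm; lra.
have PdZ x : P x -> x = (Num.floor (x / d))%:~R * d.
  move=> Px; set z := Num.floor _.
  have Pz : P (x - z%:~R * d) by apply: PB => //; apply: PMz; exact: dD.1.
  have /andP[f1 f2] := mem_rg1_floor (x / d).
  move: f1 f2; rewrite -/z ler_pdivlMr// ltr_pdivrMr// mulrDl mul1r => f1 f2.
  apply: contrapT => /eqP xz.
  have : d <= x - z%:~R * d.
    apply: ge_inf; first exact: infD.2.
    by split => //; rewrite lt_neqAle subr_ge0 f1 andbT eq_sym subr_eq0.
  by lra.
have mS :
    measurable ([set k.+1%:R * d | k in [set: nat]] : set (measurableTypeR R)).
  rewrite -bigcup_imset1; apply: bigcup_measurable => k _.
  exact: measurable_set1.
have : lattice_steps mu d.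
  split => //.
  have : mu (~` [set k.+1%:R * d | k in [set: nat]]) = 0%E.
    apply/negligibleP; first exact: measurableC.
    apply: negligibleS (negligibleU conullP null_nonpos) => x /= nx.
    apply/not_andP => -[Px]; rewrite in_itv/= andbT => x0; apply: nx.
    have xE := PdZ _ Px; move: x0; rewrite xE pmulr_lgt0// ltr0z.
    case: (Num.floor (x / d)) => [[|k]|k]// _; exists k => //.
  move=> S0; have := @probability_setC _ _ _ mu _ (measurableC mS).
  by rewrite setCK S0 sube0.
move=> dl; have [_ /(_ d)] := Span_max mu.
by rewrite span0 => /(_ (or_introl dl)); rewrite leNgt d0.
Qed.

End support.

(** * Slow variation of eventually harmonic families *)

Section slow_variation.
Context (R : realType) (M : set (realProbability R)).
Implicit Types (u : realProbability R -> R -> R) (h t : R).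

(** The bound [T0] is there because the averaging identity fails where the
    source term of the renewal equation varies; the constants are shared by
    all of [M], on which the uniformity of the conclusions rests. *)
Definition eventually_harmonic (C L T0 : R) u : Prop :=
  forall mu, M mu ->
  [/\ forall t, `|u mu t| <= C,
      forall s t, `|u mu s - u mu t| <= L * `|s - t|
    & forall t, T0 <= t -> u mu t = \int[mu]_x u mu (t - x)].

(** Localization near [mu0] and at infinity at once. Translating [t] by a
    constant preserves it, so that shifts can be iterated. *)
Definition locally_eventually (mu0 : realProbability R)
    (P : realProbability R -> R -> Prop) : Prop :=
  exists N : set (weak_probability R), exists T : R,
    nbhs (mu0 : weak_probability R) N /\
    forall mu t, N mu -> M mu -> T <= t -> P mu t.

Section local.
Variable mu0 : realProbability R.
Let ev := locally_eventually mu0.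

Lemma locally_eventuallyW (P Q : realProbability R -> R -> Prop) :
  (forall mu t, M mu -> P mu t -> Q mu t) -> ev P -> ev Q.
Proof.
move=> PQ [N [T [nN NP]]]; exists N, T; split => // mu t Nmu Mmu Tt.
by apply: PQ => //; exact: NP.
Qed.

Lemma locally_eventually_and (P Q : realProbability R -> R -> Prop) :
  ev P -> ev Q -> ev (fun mu t => P mu t /\ Q mu t).
Proof.
move=> [N1 [T1 [n1 P1]]] [N2 [T2 [n2 P2]]].
exists (N1 `&` N2), (Num.max T1 T2); split; first exact: filterI.
move=> mu t [N1mu N2mu] Mmu; rewrite ge_max => /andP[T1t T2t].
by split; [exact: P1|exact: P2].
Qed.

Lemma locally_eventually_shift (P : realProbability R -> R -> Prop) h :
  ev P -> ev (fun mu t => P mu (t - h)).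
Proof.
move=> [N [T [nN NP]]]; exists N, (T + h); split => // mu t Nmu Mmu Tt.
by apply: NP => //; rewrite lerBrDr.
Qed.

End local.

Lemma eventually_harmonic_continuous C L T0 u mu : M mu ->
  eventually_harmonic C L T0 u -> continuous (u mu).
Proof. by move=> Mmu /(_ _ Mmu)[_ Lu _]; exact: lipschitz_continuous Lu. Qed.

Lemma eventually_harmonic_integrable C L T0 u mu t : M mu ->
  eventually_harmonic C L T0 u ->
  mu.-integrable setT (EFin \o (fun x : measurableTypeR R => u mu (t - x))).
Proof.
move=> Mmu uH; have [Cu _ _] := uH _ Mmu.
apply: (integrable_bounded _ (C := C)) => // .
apply: continuous_measurableR.
exact: continuous_reflect (eventually_harmonic_continuous Mmu uH).
Qed.

Lemma eventually_harmonic_opp C L T0 u : eventually_harmonic C L T0 u ->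
  eventually_harmonic C L T0 (fun mu t => - u mu t).
Proof.
move=> uH mu Mmu; have [Cu Lu hu] := uH _ Mmu; split.
- by move=> t; rewrite normrN.
- by move=> s t; rewrite -opprD normrN.
- move=> t Tt; rewrite [in LHS]hu// -mulN1r -RintegralZl//.
    by apply: eq_Rintegral => x _; rewrite mulN1r.
  exact: eventually_harmonic_integrable uH.
Qed.

Lemma eventually_harmonic_diff C L T0 u h : eventually_harmonic C L T0 u ->
  eventually_harmonic (2 * C) (2 * L) (T0 + `|h|)
    (fun mu t => u mu t - u mu (t - h)).
Proof.
move=> uH mu Mmu; have [Cu Lu hu] := uH _ Mmu; split.
- by move=> t; rewrite mulr2n mulrDl !mul1r (le_trans (ler_normB _ _))// lerD.
- move=> s t; rewrite (_ : _ - _ = (u mu s - u mu t)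
    - (u mu (s - h) - u mu (t - h))); last by ring.
  rewrite (le_trans (ler_normB _ _))// mulr2n !mulrDl !mul1r lerD//.
  by rewrite (le_trans (Lu _ _))// opprB addrA subrK.
- move=> t Tt; have hn := ler_norm h; have h0 := normr_ge0 h.
  rewrite (hu t); last by lra.
  rewrite (hu (t - h)); last by lra.
  rewrite -RintegralB//.
  + by apply: eq_Rintegral => x _; congr (_ - u mu _); ring.
  + exact: eventually_harmonic_integrable uH.
  + exact: eventually_harmonic_integrable uH.
Qed.

Definition bump h d (x : R) : R := Num.max 0 (1 - `|x - h| / d).

Lemma bump_continuous h d : continuous (bump h d).
Proof.
move=> x; apply: (@continuous_max _ _ (fun=> 0) (fun x => 1 - `|x - h| / d)).
  exact: cvg_cst.
apply: continuousB; first exact: cvg_cst.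
apply: continuousM; last exact: cvg_cst.
apply: continuous_comp; last exact: norm_continuous.
by apply: continuousB; [exact: cvg_id|exact: cvg_cst].
Qed.

Lemma bump_ge0 h d x : 0 <= bump h d x.
Proof. by rewrite le_max lexx. Qed.

Lemma bump_le1 h d x : 0 < d -> bump h d x <= 1.
Proof. by move=> d0; rewrite ge_max ler01 gerBl divr_ge0// ltW. Qed.

Lemma bump_norm h d x : 0 < d -> `|bump h d x| <= 1.
Proof. by move=> d0; rewrite ger0_norm ?bump_ge0 ?bump_le1. Qed.

Lemma bump_eq0 h d x : 0 < d -> d <= `|x - h| -> bump h d x = 0.
Proof.
move=> d0 dx; apply/max_idPl; rewrite subr_le0 ler_pdivlMr//.
by rewrite mul1r.
Qed.

Lemma integrable_bump (mu : realProbability R) h d : 0 < d ->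
  mu.-integrable setT (EFin \o (bump h d : measurableTypeR R -> R)).
Proof.
move=> d0; apply: (integrable_bounded _ (C := 1)) => [|x].
  by apply: continuous_measurableR; exact: bump_continuous.
exact: bump_norm.
Qed.

(** A point of the support of [mu0] stays charged, with a uniform lower bound,
    by all measures close to [mu0]: a bump is a bounded continuous function. *)
Lemma bump_mass mu0 h d : in_support mu0 h -> 0 < d ->
  exists2 p : R, 0 < p &
    locally_eventually mu0 (fun mu _ => p <= \int[mu]_x bump h d x).
Proof.
move=> hs d0.
have b0 : 0 < \int[mu0]_x bump h d x.
  apply: (@Rintegral_gt0 _ _ _ `]h - d, h + d[%classic) => //.
  - exact: hs.
  - exact: integrable_bump.
  - by move=> x; exact: bump_ge0.
  - move=> x /=; rewrite in_itv/= => xh.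
    by rewrite lt_max subr_gt0 ltr_pdivrMr// mul1r ltr_distl xh orbT.
have bb : bounded_fun (bump h d).
  exists 1; split; first exact: num_real.
  by move=> y y1 x _; apply: le_trans (ltW y1); exact: bump_norm.
exists ((\int[mu0]_x bump h d x) / 2); first exact: divr_gt0.
exists [set mu : weak_probability R |
  (\int[mu0]_x bump h d x) / 2 < \int[mu]_x bump h d x], 0.
split; last by move=> mu t /ltW.
have half_lt : (\int[mu0]_x bump h d x) / 2 < \int[mu0]_x bump h d x by lra.
exact: (weak_eval_continuous (@bump_continuous h d) bb (lt_nbhsr half_lt)).
Qed.

Hypothesis M_positive : forall mu, M mu -> on_positive mu.
Hypothesis M_tail : forall e, 0 < e ->
  exists2 a, 1 <= a & forall mu, M mu -> tail_small mu a e.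

(** A near-maximum propagates backwards by any step of the support: a harmonic
    value close to the supremum is an average of values that cannot exceed
    the supremum much, so those that carry weight must be close to it too. *)
Lemma near_maximum_step mu0 C L T0 S h u : eventually_harmonic C L T0 u ->
  0 < S -> in_support mu0 h ->
  (forall e, 0 < e -> locally_eventually mu0 (fun mu t => u mu t <= S + e)) ->
  forall eta, 0 < eta -> exists2 e, 0 < e &
    locally_eventually mu0
      (fun mu t => S - e < u mu t -> S - eta < u mu (t - h)).
Proof.
move=> uH S0 hs upper eta eta0.
have [L1 [L10 LL1]] : exists L1, 0 < L1 /\ L <= L1.
  exists (`|L| + 1); split; first by rewrite ltr_pwDr.
  by rewrite (le_trans (ler_norm L))// lerDl.
pose d := eta / 2 / L1.
have d0 : 0 < d by rewrite !divr_gt0.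
have [p p0 [N1 [T1 [n1 mass]]]] := bump_mass hs d0.
(* The loss [eta / 2 * p] is [3 * e]: it has to absorb the [e] above [S] and
   the [e] due to long steps, and still bring the mean down to [S - e]. *)
pose e := eta * p / 6.
have e0 : 0 < e by rewrite /e divr_gt0// mulr_gt0.
have [N2 [T2 [n2 up]]] := upper e e0.
have [K [K0 CK]] : exists K, 0 < K /\ C + eta <= K.
  exists (`|C| + eta); split; first by rewrite ltr_pwDr.
  by rewrite lerD2r ler_norm.
have [a a1 tail] := M_tail (divr_gt0 e0 K0).
exists e => //.
exists (N1 `&` N2), (Num.max (Num.max T0 T1) (T2 + a)).
split; first exact: filterI.
move=> mu t [N1mu N2mu] Mmu; rewrite !ge_max => /andP[/andP[T0t T1t] T2t] uS.
have [Cu Lu harm] := uH _ Mmu.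
rewrite ltNge; apply/negP => uh.
have a0 : 0 <= a by lra.
suff : u mu t <= S - e by rewrite leNgt uS.
(* A step close to [h] leads to a value below [S - eta / 2], any other step
   up to [a] to a value below [S + e], and a step beyond [a] may lead to
   times where only the bound [C] is known. *)
have pt (x : R) : 0 < x ->
    u mu (t - x) <= (S + e - eta / 2 * bump h d x) + K * excess a x.
  move=> x0.
  have b0 := bump_ge0 h d x; have b1 := bump_le1 h x d0.
  have eb : eta / 2 * bump h d x <= eta / 2.
    by rewrite ler_piMr// divr_ge0// ltW.
  have [ax|xa] := leP a x.
    have Ka : K <= K * excess a x.
      by rewrite ler_pMr// /excess ax (le_trans a1).
    have := le_trans (ler_norm _) (Cu (t - x)); lra.
  rewrite (_ : excess a x = 0) ?mulr0 ?addr0; last by rewrite /excess leNgt xa.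
  have [xh|xh] := leP d `|x - h|.
    rewrite bump_eq0// mulr0 subr0; apply: up => //; lra.
  have : u mu (t - x) - u mu (t - h) <= eta / 2.
    apply: le_trans (ler_norm _) _; apply: le_trans (Lu _ _) _.
    rewrite (_ : t - x - (t - h) = - (x - h)); last by ring.
    rewrite normrN; apply: (@le_trans _ _ (L1 * d)).
      apply: le_trans (ler_wpM2r _ LL1) _ => //.
      by rewrite ler_wpM2l ?ltW.
    by rewrite /d mulrC divfK// gt_eqF.
  lra.
have ib := integrable_bump mu h d0.
have ie := integrable_excess a0 (tail _ Mmu).
have i1 := integrable_subR (integrable_cstR mu (S + e))
  (integrable_scaleR (eta / 2) ib).
have i2 := integrable_scaleR K ie.
rewrite harm//.
apply: le_trans (le_Rintegral_positive (M_positive Mmu)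
  (eventually_harmonic_integrable t Mmu uH) (integrable_addR i1 i2) pt) _.
rewrite RintegralD// RintegralB//; last 2 first.
- exact: integrable_cstR.
- exact: integrable_scaleR.
rewrite Rintegral_probability_cst !RintegralZl//.
have m1 : eta / 2 * p <= eta / 2 * \int[mu]_x bump h d x.
  apply: ler_wpM2l; last exact: mass N1mu Mmu T1t.
  by apply/ltW/divr_gt0.
have m2 : K * \int[mu]_x excess a x <= e.
  by rewrite mulrC -ler_pdivlMr//; exact: Rintegral_excess (tail _ Mmu).
have m3 : eta / 2 * p = 3 * e by rewrite /e; field.
lra.
Qed.

Lemma near_maximum_run mu0 C L T0 S h u : eventually_harmonic C L T0 u ->
  0 < S -> in_support mu0 h ->
  (forall e, 0 < e -> locally_eventually mu0 (fun mu t => u mu t <= S + e)) ->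
  forall (k : nat) eta, 0 < eta -> exists2 e, 0 < e &
    locally_eventually mu0 (fun mu t => S - e < u mu t ->
      forall j, (j < k)%N -> S - eta < u mu (t - j%:R * h)).
Proof.
move=> uH S0 hs upper; elim=> [|k IH] eta eta0.
  exists 1 => //; exists setT, 0; split => //; exact: filterT.
have [e1 e10 ev1] := IH _ eta0.
have [e2 e20 ev2] := near_maximum_step uH S0 hs upper e10.
exists (Num.min e2 eta); first by rewrite lt_min e20.
apply: locally_eventuallyW
  (locally_eventually_and ev2 (locally_eventually_shift h ev1)).
move=> mu t Mmu [s2 s1] us j jk.
have m2 : Num.min e2 eta <= e2 by rewrite ge_min lexx.
have me : Num.min e2 eta <= eta by rewrite ge_min lexx orbT.
case: j jk => [|j] jk; first by rewrite mul0r subr0; lra.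
rewrite (_ : t - _ = t - h - j%:R * h); last by rewrite -natr1; ring.
by apply: s1 => //; apply: s2; lra.
Qed.

(** If the increments of [u] over [h] had a positive upper limit [S], they
    would be close to [S] at many consecutive times [t - j * h], and their
    sum, itself an increment of the bounded family [u], would be unbounded. *)
Lemma support_shift_le mu0 C L T0 h u : eventually_harmonic C L T0 u ->
  M mu0 -> in_support mu0 h -> forall s, 0 < s ->
  locally_eventually mu0 (fun mu t => u mu t - u mu (t - h) <= s).
Proof.
move=> uH Mmu0 hs s s0; apply: contrapT => nev.
have psiH := eventually_harmonic_diff h uH.
set psi := (fun mu t => u mu t - u mu (t - h)) in psiH.
pose E := [set c | locally_eventually mu0 (fun mu t => psi mu t <= c)].
have lbE : lbound E s.
  move=> c Ec; rewrite leNgt; apply/negP => cs; apply: nev.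
  by apply: locally_eventuallyW Ec => mu t _ /= h1; exact: le_trans h1 (ltW cs).
have infE : has_inf E.
  split; last by exists s.
  exists (2 * C), setT, 0; split; first exact: filterT.
  move=> mu t _ Mmu _; have [Cp _ _] := psiH _ Mmu.
  exact: le_trans (ler_norm _) (Cp t).
pose S := inf E.
have S0 : 0 < S.
  by apply: lt_le_trans s0 _; apply: lb_le_inf => //; exact: infE.1.
have upper e : 0 < e -> locally_eventually mu0 (fun mu t => psi mu t <= S + e).
  move=> e0; have [c Ec cS] := inf_adherent e0 infE.
  by apply: locally_eventuallyW Ec => mu t _ /= h1; exact: le_trans h1 (ltW cS).
have [k kC] : exists k : nat, 4 * C / S < k%:R.
  by exists (Num.truncn (4 * C / S)).+1; exact: truncnS_gt.
have [e e0 [N [T [nN run]]]] :=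
  near_maximum_run psiH S0 hs upper k (divr_gt0 S0 (ltr0n _ 2)).
have [mu [t [Nmu Mmu Tt pe]]] :
    exists mu t, [/\ N mu, M mu, T <= t & S - e < psi mu t].
  apply: contrapT => nex.
  have : E (S - e).
    exists N, T; split => // mu t Nmu Mmu Tt; rewrite leNgt; apply/negP => pe.
    by apply: nex; exists mu, t.
  by move=> /(ge_inf infE.2); rewrite -/S; lra.
have {}run := run mu t Nmu Mmu Tt pe.
have tele j : (j <= k)%N -> j%:R * (S / 2) <= u mu t - u mu (t - j%:R * h).
  elim: j => [|j IH] jk; first by rewrite !mul0r !subr0 subrr.
  have {}IH := IH (ltnW jk).
  have := run _ jk; rewrite /psi.
  rewrite (_ : t - j.+1%:R * h = t - j%:R * h - h); last first.
    by rewrite -natr1; ring.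
  rewrite -[j.+1%:R]natr1 mulrDl mul1r; lra.
have := tele k (leqnn k).
have [Cu _ _] := uH _ Mmu.
have := le_trans (ler_norm _) (Cu t).
have : - u mu (t - k%:R * h) <= C.
  by apply: le_trans (ler_norm _) _; rewrite normrN.
move: kC; rewrite ltr_pdivrMr//.
lra.
Qed.

Lemma support_shift mu0 C L T0 h u : eventually_harmonic C L T0 u ->
  M mu0 -> in_support mu0 h -> forall s, 0 < s ->
  locally_eventually mu0 (fun mu t => `|u mu t - u mu (t - h)| <= s).
Proof.
move=> uH Mmu0 hs s s0.
have e1 := support_shift_le uH Mmu0 hs s0.
have e2 := support_shift_le (eventually_harmonic_opp uH) Mmu0 hs s0.
apply: locally_eventuallyW (locally_eventually_and e1 e2) => mu t _ [h1 h2].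
by rewrite ler_norml; apply/andP; split; lra.
Qed.

(** The shifts that asymptotically leave [u] unchanged near [mu0] form a closed
    subgroup that contains the support of [mu0], hence the whole line. *)
Lemma slow_variation C L T0 u : eventually_harmonic C L T0 u ->
  weakly_compact M -> (forall mu, M mu -> Span mu = 0) ->
  forall h s, 0 < s -> \forall t \near +oo, forall mu, M mu ->
    `|u mu t - u mu (t - h)| <= s.
Proof.
move=> uH cM spanM h s s0; apply: compact_eventually => // mu0 Mmu0.
pose P h := forall s, 0 < s ->
  locally_eventually mu0 (fun mu t => `|u mu t - u mu (t - h)| <= s).
suff /(_ s s0)[N [T [nN NT]]] : P h.
  have nT : \forall t \near +oo, T <= t.
    by apply: nbhs_pinfty_ge; exact: num_real.
  exists (N, [set t | T <= t]) => //.
  by move=> [mu t] [/= Nmu Tt] Mmu; exact: NT.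
apply: (@nonlattice_closed_subgroup _ _ P (M_positive Mmu0) (spanM _ Mmu0)).
- move=> e e0; exists setT, 0; split; first exact: filterT.
  by move=> mu t _ _ _; rewrite subr0 subrr normr0 ltW.
- move=> x y Px Py e e0; have e2 := divr_gt0 e0 (ltr0n R 2).
  have := locally_eventually_and
    (locally_eventually_shift (x - y) (Py _ e2)) (Px _ e2).
  apply: locally_eventuallyW => mu t _ [h1 h2].
  rewrite (_ : t - (x - y) - y = t - x) in h1; last by ring.
  rewrite distrC in h1.
  have := ler_distD (u mu (t - x)) (u mu t) (u mu (t - (x - y))).
  lra.
- move=> x clx e e0.
  have [L1 [L10 LL1]] : exists L1, 0 < L1 /\ L <= L1.
    exists (`|L| + 1); split; first by rewrite ltr_pwDr.
    by rewrite (le_trans (ler_norm L))// lerDl.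
  have e2 := divr_gt0 e0 (ltr0n R 2).
  have [y Py xy] := clx _ (divr_gt0 e2 L10).
  apply: locally_eventuallyW (Py _ e2) => mu t Mmu h1.
  have [_ Lu _] := uH _ Mmu.
  have h2 : `|u mu (t - y) - u mu (t - x)| <= e / 2.
    apply: le_trans (Lu _ _) _.
    rewrite (_ : t - y - (t - x) = x - y); last by ring.
    apply: le_trans (ler_wpM2r _ LL1) _ => //.
    by move: xy; rewrite ltr_pdivlMr// mulrC => /ltW.
  have := ler_distD (u mu (t - y)) (u mu t) (u mu (t - x)).
  lra.
- by move=> x xs e e0; exact: support_shift uH Mmu0 xs e e0.
Qed.

End slow_variation.

(** * Supersolutions of the renewal equation *)

Section supersolution.
Context (R : realType) (mu : realProbability R).
Hypothesis mu_positive : on_positive mu.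
Implicit Types (f g : R -> R) (t : R).

(** The renewal convolution is the least nonnegative solution of the renewal
    equation. Since the steps are positive, its values up to [T] only depend on
    what happens up to [T]. *)
Lemma renewal_supersolution f g T t : (forall x, 0 <= f x) ->
  measurable_fun [set: measurableTypeR R] (f : _ -> measurableTypeR R) ->
  measurable_fun [set: measurableTypeR R] (g : _ -> measurableTypeR R) ->
  (forall x, 0 <= g x) ->
  (forall x, x <= T -> ((f x)%:E + \int[mu]_y (g (x - y))%:E <= (g x)%:E)%E) ->
  t <= T -> (renewal_conv mu f t <= (g t)%:E)%E.
Proof.
move=> f0 mf mg g0 fg tT; rewrite renewal_convE//.
have S N x : x <= T -> (\sum_(0 <= n < N) power_conv mu n f x <= (g x)%:E)%E.
  elim: N x => [|N IH] x xT; first by rewrite big_geq// lee_fin.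
  apply: le_trans (fg x xT).
  rewrite big_nat_recl// power_conv0// leeD2l//.
  under eq_bigr do rewrite power_convS//.
  rewrite -ge0_integral_sum//; last 2 first.
  - by move=> n; exact: measurable_power_conv.
  - by move=> n y _; exact: power_conv_ge0.
  apply: le_integral_positive => //.
  - by apply: emeasurable_sum => n; exact: measurable_power_conv.
  - by apply/measurable_EFinP; exact: measurable_fun_reflect.
  - by move=> y; apply: sume_ge0 => n _; exact: power_conv_ge0.
  - by move=> y; rewrite lee_fin.
  - by move=> y y0; apply: IH; lra.
apply: lime_le; last by apply: nearW => N; exact: S.
by apply: is_cvg_nneseries => n _ _; exact: power_conv_ge0.
Qed.

End supersolution.

Section clamp.
Context (R : realType).
Implicit Types d x y t : R.

Definition clamp d y : R := Num.min (Num.max y 0) d.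

Variant clamp_spec d y : R -> Type :=
| ClampLow of y <= 0 : clamp_spec d y 0
| ClampMid of 0 <= y & y <= d : clamp_spec d y y
| ClampHigh of d <= y & 0 <= y : clamp_spec d y d.

Lemma clampP d y : 0 <= d -> clamp_spec d y (clamp d y).
Proof.
move=> d0; rewrite /clamp; case: (leP y 0) => y0.
  by rewrite (min_idPl d0); exact: ClampLow.
by case: (leP y d) => yd; [apply: ClampMid|apply: ClampHigh]; rewrite // ltW.
Qed.

Lemma clamp_high d y : 0 <= d -> d <= y -> clamp d y = d.
Proof.
move=> d0 dy; rewrite /clamp (max_idPl (le_trans d0 dy)).
exact: (min_idPr dy).
Qed.

Lemma clamp_ge0 d y : 0 <= d -> 0 <= clamp d y.
Proof. by move=> d0; case: clampP. Qed.

Lemma clamp_le d y : 0 <= d -> clamp d y <= d.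
Proof. by move=> d0; case: clampP. Qed.

Lemma le_clamp d x y : 0 <= d -> x <= y -> clamp d x <= clamp d y.
Proof. by move=> d0 xy; case: clampP => //; case: clampP => //; lra. Qed.

Lemma clamp_continuous d : continuous (clamp d).
Proof.
move=> x; apply: (@continuous_min _ _ (fun x : R => Num.max x 0) (fun=> d)).
  by apply: (@continuous_max _ _ id (fun=> 0)); [exact: cvg_id|exact: cvg_cst].
exact: cvg_cst.
Qed.

Lemma measurable_clamp d :
  measurable_fun [set: measurableTypeR R] (clamp d : _ -> measurableTypeR R).
Proof. by apply: continuous_measurableR; exact: clamp_continuous. Qed.

Definition clamp_increment d r y : R := clamp d (y + r) - clamp d y.

Lemma clamp_increment_ge0 d r y : 0 <= d -> 0 <= r ->
  0 <= clamp_increment d r y.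
Proof. by move=> d0 r0; rewrite subr_ge0 le_clamp// lerDl. Qed.

Lemma clamp_increment_le d r y : 0 <= d -> 0 <= r ->
  clamp_increment d r y <= Num.min r d.
Proof.
move=> d0 r0; rewrite /clamp_increment le_min; apply/andP.
by case: clampP => // y1; case: clampP => // y2; split; lra.
Qed.

Lemma clamp_increment_eq0 d r y : 0 <= d -> 0 <= r ->
  ~~ (- r <= y <= d) -> clamp_increment d r y = 0.
Proof.
move=> d0 r0; rewrite negb_and -!ltNge /clamp_increment.
by move=> /orP[] ?; case: clampP => // *; case: clampP => // *; lra.
Qed.

Lemma measurable_clamp_increment d r :
  measurable_fun [set: measurableTypeR R]
    (clamp_increment d r : _ -> measurableTypeR R).
Proof.
apply: measurable_funB; last exact: measurable_clamp.
apply: (measurableT_comp (measurable_clamp d)).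
exact: measurable_funD.
Qed.

End clamp.

Section renewal_bound.
Context (R : realType) (mu : realProbability R) (m : R).
Hypotheses (mu_positive : on_positive mu) (m0 : 0 < m).
Hypothesis mu_m : m <= truncated_mean mu.
Implicit Types (f : R -> R) (t : R).

(** Uniform local boundedness of the renewal measure. The supersolution is an
    affine ramp of slope [c / m] on an interval that begins one unit before
    [a]: one step of the walk lowers it, at a point of [a, b], by at least [c
    / m * min(X, 1)], whose mean is at least [c]. *)
Lemma renewal_conv_bound f (c a b T t : R) : 0 <= c -> a <= b -> t <= T ->
  (forall x, 0 <= f x) ->
  measurable_fun [set: measurableTypeR R] (f : _ -> measurableTypeR R) ->
  (forall x, x <= T -> f x <= c) ->
  (forall x, x <= T -> ~~ (a <= x <= b) -> f x = 0) ->
  (renewal_conv mu f t <= (c / m * (b - a + 1))%:E)%E.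
Proof.
move=> c0 ab tT f0 mf fc fab.
have d0 : 0 <= b - a + 1 by lra.
have K0 : 0 <= c / m by rewrite divr_ge0// ltW.
pose g x := c / m * clamp (b - a + 1) (x - a + 1).
have g0 x : 0 <= g x by rewrite mulr_ge0// clamp_ge0.
have gle x : g x <= c / m * (b - a + 1) by rewrite ler_wpM2l// clamp_le.
have mg : measurable_fun [set: measurableTypeR R] (g : _ -> measurableTypeR R).
  apply: measurable_funM; first exact: measurable_cst.
  apply: (measurableT_comp (measurable_clamp _)).
  by apply: measurable_funD; [exact: measurable_funB|exact: measurable_cst].
apply: le_trans (_ : (g t)%:E <= _)%E; last by rewrite lee_fin.
apply: (renewal_supersolution mu_positive (T := T)) => // x xT.
have intg :
    mu.-integrable setT (EFin \o (fun y : measurableTypeR R => g (x - y))).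
  apply: (integrable_bounded _ (C := c / m * (b - a + 1))) => [|y].
    exact: measurable_fun_reflect.
  by rewrite ger0_norm.
have gmono y : 0 < y -> g (x - y) <= g x.
  by move=> y0; rewrite ler_wpM2l// le_clamp//; lra.
rewrite -[X in (_ + X)%E]fineK; last first.
  exact: (integrable_fin_num measurableT intg).
rewrite lee_fin -/(Rintegral mu setT (fun y => g (x - y))).
have [axb|axb] := boolP (a <= x <= b); last first.
  rewrite fab// add0r -[leRHS](Rintegral_probability_cst mu).
  by apply: le_Rintegral_positive => //; exact: integrable_cstR.
apply: (@le_trans _ _ (c / m * truncated_mean mu + \int[mu]_y g (x - y))).
  rewrite lerD2r (le_trans (fc x xT))// -{1}(divfK (lt0r_neq0 m0) c).
  by rewrite ler_wpM2l.
have it := integrable_truncation mu.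
have ict := integrable_scaleR (c / m) it.
rewrite /truncated_mean -RintegralZl// -RintegralD//.
rewrite -[leRHS](Rintegral_probability_cst mu).
apply: le_Rintegral_positive => //.
- exact: integrable_addR.
- exact: integrable_cstR.
- move=> y y0; rewrite /g -mulrDr ler_wpM2l//.
  move: axb => /andP[ax xb]; rewrite gtr0_norm//.
  have h1 : Num.min y 1 <= y by rewrite ge_min lexx.
  have h2 : Num.min y 1 <= 1 by rewrite ge_min lexx orbT.
  by case: clampP => // ?; case: clampP => // ?; lra.
Qed.

End renewal_bound.

(** * The smoothed renewal function *)

Section smoothed.
Context (R : realType).

(** The integral of the renewal function [t |-> U [0, t]] over a window of
    length [d]: unlike the renewal function itself, it is Lipschitz, and its
    increments of step [r] are the convolutions of the renewal measure with
    the trapezoid [clamp_increment d r]. *)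
Definition smoothed (d : R) (mu : realProbability R) (t : R) : R :=
  fine (renewal_conv mu (clamp d) t).

(** A Lipschitz constant of [smoothed d] that depends on the measure only
    through the lower bound [m] of its truncated mean. *)
Definition smoothed_lip (m d : R) : R := (1 + d) * (2 + d) / m.

Section one_measure.
Context (mu : realProbability R) (m d : R).
Hypotheses (mu_positive : on_positive mu) (m0 : 0 < m) (d0 : 0 <= d).
Hypothesis mu_m : m <= truncated_mean mu.
Implicit Types r t x : R.
Let C := smoothed_lip m d.

Lemma smoothed_lip_ge0 : 0 <= C.
Proof. by rewrite /C /smoothed_lip divr_ge0 ?mulr_ge0 ?addr_ge0// ltW. Qed.

Lemma renewal_conv_ge0 f t : (forall x, 0 <= f x) ->
  (0 <= renewal_conv mu f t)%E.
Proof. by move=> f0; apply: integral_ge0 => x _; rewrite lee_fin. Qed.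

Lemma renewal_conv_fin (f : R -> R) t b : (forall x, 0 <= f x) ->
  (renewal_conv mu f t <= b%:E)%E -> renewal_conv mu f t \is a fin_num.
Proof.
move=> f0 fb; rewrite ge0_fin_numE; last exact: renewal_conv_ge0.
exact: le_lt_trans fb (ltry _).
Qed.

Lemma smoothed_fin t : renewal_conv mu (clamp d) t \is a fin_num.
Proof.
pose T := Num.max t 0.
have T0 : 0 <= T by rewrite le_max lexx orbT.
have tT : t <= T by rewrite le_max lexx.
apply: (renewal_conv_fin (b := d / m * (T - 0 + 1))) => [x|].
  exact: clamp_ge0.
apply: (renewal_conv_bound mu_positive m0 mu_m (T := T)) => //.
- by move=> x; exact: clamp_ge0.
- exact: measurable_clamp.
- by move=> x _; exact: clamp_le.
- move=> x xT; rewrite xT andbT -ltNge => x0.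
  by case: clampP => // *; lra.
Qed.

Lemma smoothedK t : (smoothed d mu t)%:E = renewal_conv mu (clamp d) t.
Proof. exact: fineK (smoothed_fin t). Qed.

Lemma smoothed_ge0 t : 0 <= smoothed d mu t.
Proof. by rewrite fine_ge0// renewal_conv_ge0// => x; exact: clamp_ge0. Qed.

Lemma smoothed_increment t r : 0 <= r ->
  (smoothed d mu (t + r) - smoothed d mu t)%:E
  = renewal_conv mu (clamp_increment d r) t.
Proof.
move=> r0; rewrite EFinB !smoothedK.
have -> : renewal_conv mu (clamp d) (t + r) =
    (renewal_conv mu (clamp_increment d r) t + renewal_conv mu (clamp d) t)%E.
  rewrite /renewal_conv -ge0_integralD//; last 4 first.
  - by move=> x _; rewrite lee_fin clamp_increment_ge0.
  - apply/measurable_EFinP; apply: measurable_fun_reflect.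
    exact: measurable_clamp_increment.
  - by move=> x _; rewrite lee_fin clamp_ge0.
  - apply/measurable_EFinP; apply: measurable_fun_reflect.
    exact: measurable_clamp.
  apply: eq_integral => x _; rewrite -EFinD /clamp_increment subrK.
  by congr (clamp _ _)%:E; rewrite addrAC.
by rewrite addeK// smoothed_fin.
Qed.

Lemma smoothed_increment_ge0 t r : 0 <= r ->
  0 <= smoothed d mu (t + r) - smoothed d mu t.
Proof.
move=> r0; rewrite -lee_fin smoothed_increment// renewal_conv_ge0// => x.
exact: clamp_increment_ge0.
Qed.

(** For small [r] the trapezoid has height [r], for large [r] it has height
    [d]; in both cases the bound is linear in [r]. *)
Lemma smoothed_increment_le t r : 0 <= r ->
  smoothed d mu (t + r) - smoothed d mu t <= C * r.
Proof.
move=> r0; rewrite -lee_fin smoothed_increment//.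
pose c := Num.min r d; pose T := Num.max t d.
have c0 : 0 <= c by rewrite le_min r0.
have cr : c <= r by rewrite ge_min lexx.
have cd : c <= d by rewrite ge_min lexx orbT.
apply: (@le_trans _ _ (c / m * (d - (- r) + 1))%:E).
  apply: (renewal_conv_bound mu_positive m0 mu_m (T := T)) => //.
  - by lra.
  - by rewrite le_max lexx.
  - by move=> x; exact: clamp_increment_ge0.
  - exact: measurable_clamp_increment.
  - by move=> x _; exact: clamp_increment_le.
  - by move=> x _; exact: clamp_increment_eq0.
rewrite lee_fin /C /smoothed_lip mulrAC [leRHS]mulrAC ler_pM2r ?invr_gt0//.
have [r1|r1] := leP r 1; nra.
Qed.

Lemma smoothed_lipschitz s t :
  `|smoothed d mu s - smoothed d mu t| <= C * `|s - t|.
Proof.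
wlog st : s t / t <= s => [wl|].
  have [st|/ltW st] := leP t s; first exact: wl.
  by rewrite distrC [X in _ * X]distrC wl.
have r0 : 0 <= s - t by rewrite subr_ge0.
have := smoothed_increment_le t r0; have := smoothed_increment_ge0 t r0.
by rewrite (addrC t) subrK => ? ?; rewrite !ger0_norm.
Qed.

Lemma smoothed_continuous : continuous (smoothed d mu).
Proof. exact: lipschitz_continuous smoothed_lipschitz. Qed.

Lemma smoothed_integral_fin t :
  (\int[mu]_x (smoothed d mu (t - x))%:E \is a fin_num)%E.
Proof.
have := renewal_equation mu t (fun x => @clamp_ge0 R d x d0)
  (measurable_clamp d).
under eq_integral do rewrite -smoothedK.
rewrite -smoothedK => e.
rewrite ge0_fin_numE; last first.
  by apply: integral_ge0 => x _; rewrite lee_fin smoothed_ge0.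
apply: le_lt_trans (ltry (smoothed d mu t)).
by rewrite e leeDr// lee_fin clamp_ge0.
Qed.

Lemma integrable_smoothed t : mu.-integrable setT
  (EFin \o (fun x : measurableTypeR R => smoothed d mu (t - x))).
Proof.
apply/integrableP; split.
  apply/measurable_EFinP; apply: measurable_fun_reflect.
  by apply: continuous_measurableR; exact: smoothed_continuous.
under eq_integral => x _ do rewrite /= ger0_norm ?smoothed_ge0//.
by rewrite -ge0_fin_numE ?smoothed_integral_fin// integral_ge0// => x _;
  rewrite lee_fin smoothed_ge0.
Qed.

Lemma smoothed_equation t :
  smoothed d mu t = clamp d t + \int[mu]_x smoothed d mu (t - x).
Proof.
have := renewal_equation mu t (fun x => @clamp_ge0 R d x d0)
  (measurable_clamp d).
under eq_integral do rewrite -smoothedK.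
rewrite -smoothedK -[X in (_ + X)%E](fineK (smoothed_integral_fin t)) -EFinD.
by case.
Qed.

(** Beyond the window the source term of the renewal equation is constant
    equal to [d], so that the mean decrease of [smoothed] over one step of
    the walk is known exactly. *)
Lemma smoothed_drift t : d <= t ->
  \int[mu]_x (smoothed d mu t - smoothed d mu (t - x)) = d.
Proof.
move=> dt; rewrite RintegralB//; last 2 first.
- exact: integrable_cstR.
- exact: integrable_smoothed.
rewrite Rintegral_probability_cst [X in X - _]smoothed_equation addrK.
exact: clamp_high.
Qed.

End one_measure.

Definition smoothed_step (d eta : R) (mu : realProbability R) (t : R) : R :=
  smoothed d mu t - smoothed d mu (t - eta).

Section family.
Context (M : set (realProbability R)) (m : R).
Hypothesis M_positive : forall mu, M mu -> on_positive mu.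
Hypotheses (m0 : 0 < m) (M_m : forall mu, M mu -> m <= truncated_mean mu).

Lemma smoothed_step_harmonic d eta : 0 <= d -> 0 < eta ->
  eventually_harmonic M (smoothed_lip m d * eta) (2 * smoothed_lip m d)
    (d + eta) (smoothed_step d eta).
Proof.
move=> d0 eta0 mu Mmu; have mup := M_positive Mmu; have mum := M_m Mmu.
have lip := smoothed_lipschitz mup m0 d0 mum.
split.
- move=> t; rewrite /smoothed_step (le_trans (lip _ _))//.
  by rewrite opprB addrCA subrr addr0 gtr0_norm.
- move=> s t; rewrite /smoothed_step.
  rewrite (_ : _ - _ = (smoothed d mu s - smoothed d mu t)
    - (smoothed d mu (s - eta) - smoothed d mu (t - eta))); last by ring.
  rewrite (le_trans (ler_normB _ _))// -mulrA mulr2n mulrDl mul1r lerD//.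
  by rewrite (le_trans (lip _ _))// opprB addrA subrK.
- move=> t Tt; rewrite /smoothed_step.
  rewrite (smoothed_equation mup m0 d0 mum t).
  rewrite (smoothed_equation mup m0 d0 mum (t - eta)).
  have -> : clamp d t = d by apply: clamp_high => //; lra.
  have -> : clamp d (t - eta) = d by apply: clamp_high => //; lra.
  rewrite opprD addrACA subrr add0r -RintegralB//; last 2 first.
  + exact: (integrable_smoothed mup m0 d0 mum).
  + exact: (integrable_smoothed mup m0 d0 mum).
  by apply: eq_Rintegral => x _; congr (_ - smoothed _ _ _); ring.
Qed.

End family.

End smoothed.

(** * Blackwell's theorem, uniformly *)

Section mean.
Context (R : realType) (mu : realProbability R) (m a e : R).
Hypotheses (mu_positive : on_positive mu) (m0 : 0 < m).
Hypotheses (mu_m : m <= truncated_mean mu) (a0 : 0 <= a).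
Hypothesis mu_tail : tail_small mu a e.

Lemma integrable_identity :
  mu.-integrable setT (EFin \o (fun x : measurableTypeR R => x : R)).
Proof.
apply: le_integrable (integrable_id a0 mu_positive mu_tail) => //.
  by apply/measurable_EFinP; exact: measurable_id.
by move=> x _; rewrite /= lee_fin normr_id.
Qed.

Lemma renewal_rateE : renewal_rate mu = (\int[mu]_x x)^-1.
Proof.
by rewrite /renewal_rate (Rintegral_positive mu_positive integrable_identity).
Qed.

Lemma le_mean : m <= \int[mu]_x x.
Proof.
apply: le_trans mu_m _; apply: le_Rintegral_positive => //.
- exact: integrable_truncation.
- exact: integrable_identity.
- by move=> x x0; rewrite gtr0_norm// ge_min lexx.
Qed.

Lemma renewal_rate_gt0 : 0 < renewal_rate mu.
Proof. by rewrite renewal_rateE invr_gt0 (lt_le_trans m0 le_mean). Qed.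

Lemma renewal_rate_le : renewal_rate mu <= m^-1.
Proof.
rewrite renewal_rateE lef_pV2 ?le_mean// posrE//.
exact: lt_le_trans m0 le_mean.
Qed.

End mean.

Section slope.
Context (R : realType).
Implicit Types (v : R -> R) (C eta eps t x : R).

(** Up to a multiple of [eta], [x] is a sum of [J] or fewer steps [eta], over
    each of which the decrement of [v] is nearly the one at [t]. *)
Lemma almost_affine v C eta eps t (J : nat) x : 0 < eta -> 0 <= C -> 0 <= eps ->
  (forall s s', `|v s - v s'| <= C * `|s - s'|) ->
  (forall j, (j < J)%N ->
    `|(v t - v (t - eta)) - (v (t - j%:R * eta) - v (t - j%:R * eta - eta))|
    <= eps) ->
  0 < x -> x < J%:R * eta ->
  `|v t - v (t - x) - x / eta * (v t - v (t - eta))|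
  <= 2 * C * eta + J%:R * eps.
Proof.
move=> eta0 C0 eps0 lip slow x0 xJ.
set w := v t - v (t - eta).
have xe0 : 0 <= x / eta by rewrite divr_ge0// ltW.
have /andP[k1 k2] := truncn_itv xe0.
set k := Num.truncn (x / eta) in k1 k2.
have kJ : (k <= J)%N.
  rewrite -(@ler_nat R) (le_trans k1)// ler_pdivrMr//; exact: ltW.
have tele j : (j <= k)%N ->
    `|v t - v (t - j%:R * eta) - j%:R * w| <= j%:R * eps.
  elim: j => [|j IH] jk; first by rewrite !mul0r !subr0 subrr normr0.
  have {}IH := IH (ltnW jk).
  have := slow j (leq_trans jk kJ); rewrite -/w.
  rewrite (_ : t - j.+1%:R * eta = t - j%:R * eta - eta); last first.
    by rewrite -[j.+1%:R]natr1; ring.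
  rewrite -[j.+1%:R]natr1 !mulrDl !mul1r.
  rewrite !ler_norml => /andP[? ?]; move: IH; rewrite ler_norml => /andP[? ?].
  by apply/andP; split; lra.
have := tele k (leqnn k).
have : `|v (t - k%:R * eta) - v (t - x)| <= C * eta.
  apply: le_trans (lip _ _) _; rewrite ler_wpM2l//.
  rewrite (_ : t - k%:R * eta - (t - x) = x - k%:R * eta); last by ring.
  move: k1 k2; rewrite ler_pdivlMr// ltr_pdivrMr// -natr1 mulrDl mul1r => k1 k2.
  by rewrite ger0_norm; lra.
have : `|(x / eta - k%:R) * w| <= C * eta.
  have h1 : 0 <= x / eta - k%:R by rewrite subr_ge0.
  have h2 : x / eta - k%:R <= 1.
    by rewrite lerBlDr addrC natr1 ltW.
  rewrite normrM (ger0_norm h1) (le_trans (ler_piMl _ h2))//.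
  by rewrite (le_trans (lip _ _))// opprB addrCA subrr addr0 gtr0_norm.
have kJe : k%:R * eps <= J%:R * eps by rewrite ler_wpM2r// ler_nat.
rewrite mulrBl !ler_norml => /andP[? ?] /andP[? ?] /andP[? ?].
by apply/andP; split; lra.
Qed.

End slope.

Section blackwell.
Context (R : realType) (M : set (realProbability R)) (m : R).
Hypothesis M_positive : forall mu, M mu -> on_positive mu.
Hypotheses (m0 : 0 < m) (M_m : forall mu, M mu -> m <= truncated_mean mu).
Hypothesis M_tail : forall e, 0 < e ->
  exists2 a, 1 <= a & forall mu, M mu -> tail_small mu a e.
Hypothesis M_compact : weakly_compact M.
Hypothesis M_span : forall mu, M mu -> Span mu = 0.

(** The drift identity [smoothed_drift] fixes the asymptotic slope: near [t]
    the smoothed renewal function is almost affine, and its mean increment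
    over one step of the walk is exactly [d]. Long steps are controlled by
    uniform integrability. *)
Lemma smoothed_slope d eta e : 0 <= d -> 0 < eta -> 0 < e ->
  \forall t \near +oo, forall mu, M mu ->
    `|smoothed_step d eta mu t / eta - renewal_rate mu * d|
      <= (2 * smoothed_lip m d * eta + e) / m.
Proof.
move=> d0 eta0 e0; set C := smoothed_lip m d.
have C0 : 0 <= C by exact: smoothed_lip_ge0.
have C1 : 0 < 4 * (C + 1) by lra.
have [a a1 tail] := M_tail (divr_gt0 e0 C1).
have a0 : 0 <= a by lra.
(* [J] steps of length [eta] cover every step of the walk up to [a]. *)
pose J := (Num.truncn (a / eta)).+1.
have aJ : a < J%:R * eta by rewrite -ltr_pdivrMr// truncnS_gt.
have J0 : 0 < J%:R :> R by rewrite ltr0n.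
pose eps := e / 2 / J%:R.
have eps0 : 0 < eps by rewrite /eps !divr_gt0.
have uH := smoothed_step_harmonic M_positive m0 M_m d0 eta0.
have slow j : \forall t \near +oo, forall mu, M mu ->
    `|smoothed_step d eta mu t - smoothed_step d eta mu (t - j%:R * eta)|
    <= eps.
  exact: (slow_variation M_positive M_tail uH M_compact M_span).
have slowJ K : \forall t \near +oo, forall j, (j < K)%N -> forall mu, M mu ->
    `|smoothed_step d eta mu t - smoothed_step d eta mu (t - j%:R * eta)|
    <= eps.
  elim: K => [|K IH]; first by apply: nearW.
  apply: filterS2 IH (slow K) => t IH sK j; rewrite ltnS leq_eqVlt.
  by case/orP => [/eqP -> //|]; exact: IH.
have nd : \forall t \near +oo, d <= t.
  by apply: nbhs_pinfty_ge; exact: num_real.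
apply: filterS2 (slowJ J) nd => t {}slow dt mu Mmu.
have mup := M_positive Mmu; have mum := M_m Mmu.
have lip := smoothed_lipschitz mup m0 d0 mum.
have drift := smoothed_drift mup m0 d0 mum dt.
have isd := integrable_smoothed mup m0 d0 mum t.
have tl := tail _ Mmu.
have iid := integrable_identity mup a0 tl.
have iex := integrable_excess a0 tl.
have iD := integrable_subR (integrable_cstR mu (smoothed d mu t)) isd.
set w := smoothed_step d eta mu t.
pose B := 2 * C * eta + J%:R * eps.
have pt (x : R) : 0 < x ->
    `|smoothed d mu t - smoothed d mu (t - x) - w / eta * x|
    <= B + 2 * C * excess a x.
  move=> x0; rewrite -mulrA [eta^-1 * x]mulrC [w * _]mulrC.
  have [ax|xa] := leP a x; last first.
    rewrite (_ : excess a x = 0) ?mulr0 ?addr0; last first.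
      by rewrite /excess leNgt xa.
    apply: almost_affine => //; first exact: ltW.
    - by move=> j jJ; exact: slow.
    - exact: lt_trans xa aJ.
  rewrite /excess ax (le_trans (ler_normB _ _))//.
  have B0 : 0 <= B.
    apply: addr_ge0; apply: mulr_ge0 => //; try exact: ltW.
    exact: mulr_ge0.
  have h1 : `|smoothed d mu t - smoothed d mu (t - x)| <= C * x.
    by rewrite (le_trans (lip _ _))// opprB addrCA subrr addr0 gtr0_norm.
  have h2 : `|x / eta * w| <= C * x.
    have xe : 0 <= x / eta by rewrite divr_ge0// ltW.
    rewrite normrM ger0_norm// mulrAC ler_pdivrMr//.
    rewrite [leRHS]mulrAC [leRHS]mulrC ler_wpM2l//; first exact: ltW.
    have [wC _ _] := uH _ Mmu; exact: wC.
  lra.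
have iw := integrable_scaleR (w / eta) iid.
have iB :=
  integrable_addR (integrable_cstR mu B) (integrable_scaleR (2 * C) iex).
have key : `|d - w / eta * \int[mu]_x x| <= 2 * C * eta + e.
  have intE : \int[mu]_x (smoothed d mu t - smoothed d mu (t - x) - w / eta * x)
      = d - w / eta * \int[mu]_x x.
    by rewrite RintegralB// RintegralZl// drift.
  have intB : \int[mu]_x (B + 2 * C * excess a x) <= 2 * C * eta + e.
    rewrite RintegralD//; last 2 first.
    - exact: integrable_cstR.
    - exact: integrable_scaleR.
    rewrite Rintegral_probability_cst RintegralZl//.
    have h1 := Rintegral_excess a0 tl.
    have h2 : 2 * C * \int[mu]_x excess a x <= e / 2.
      apply: le_trans (ler_wpM2l _ h1) _; first by rewrite mulr_ge0.
      rewrite mulrA ler_pdivrMr//; nra.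
    have h3 : J%:R * eps = e / 2 by rewrite /eps mulrC divfK// gt_eqF.
    rewrite /B h3; lra.
  rewrite -intE ler_norml; apply/andP; split.
    rewrite lerNl; apply: le_trans intB.
    rewrite -mulN1r -RintegralZl//; last exact: integrable_subR.
    apply: le_Rintegral_positive => //.
      by apply: integrable_scaleR; exact: integrable_subR.
    by move=> x x0; have := pt _ x0; rewrite ler_norml => /andP[]; lra.
  apply: le_trans intB; apply: le_Rintegral_positive => //.
    exact: integrable_subR.
  by move=> x x0; have := pt _ x0; rewrite ler_norml => /andP[].
have rE := renewal_rateE mup a0 tl.
have r0 := renewal_rate_gt0 mup m0 mum a0 tl.
have rle := renewal_rate_le mup m0 mum a0 tl.
have mean0 : 0 < \int[mu]_x x by exact: lt_le_trans m0 (le_mean mup mum a0 tl).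
rewrite (_ : _ - _ =
  - (renewal_rate mu * (d - w / eta * \int[mu]_x x))); last first.
  by rewrite mulrBr (mulrCA (renewal_rate mu)) rE mulVf ?gt_eqF// mulr1 opprB.
rewrite normrN normrM gtr0_norm// mulrC.
apply: ler_pM => //; exact: ltW.
Qed.

Definition window (d : R) (x : R) : R := if 0 <= x < d then 1 else 0.

Lemma windowE d (x : R) : window d x = \1_(`[0, d[%classic : set R) x.
Proof.
rewrite /window indicE mem_setE in_itv/=.
by case: ifP.
Qed.

Lemma measurable_window d :
  measurable_fun [set: measurableTypeR R] (window d : _ -> measurableTypeR R).
Proof.
rewrite (_ : window d = \1_(`[0, d[%classic : set R)); last first.
  by apply/funext => x; exact: windowE.
exact: measurable_indic.
Qed.

Lemma window_ge0 d x : 0 <= window d x.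
Proof. by rewrite /window; case: ifP. Qed.

(** The renewal measure of the interval from [t - d] (excluded) to [t]
    (included). *)
Definition renewal_window d mu t : R := fine (renewal_conv mu (window d) t).

Lemma renewal_window_bound d mu t : 0 <= d -> M mu ->
  (renewal_conv mu (window d) t <= ((d + 1) / m)%:E)%E.
Proof.
move=> d0 Mmu; have mup := M_positive Mmu; have mum := M_m Mmu.
apply: (@le_trans _ _ (1 / m * (d - 0 + 1))%:E).
  apply: (renewal_conv_bound mup m0 mum (T := t)) => //.
  - exact: window_ge0.
  - exact: measurable_window.
  - by move=> x _; rewrite /window; case: ifP.
  - move=> x _; rewrite /window; case: ifP => // /andP[-> xd].
    by rewrite ltW.
by rewrite lee_fin subr0 mulrC mulrA mulr1.
Qed.

Lemma renewal_windowK d mu t : 0 <= d -> M mu ->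
  (renewal_window d mu t)%:E = renewal_conv mu (window d) t.
Proof.
move=> d0 Mmu; apply: fineK.
apply: renewal_conv_fin (renewal_window_bound t d0 Mmu).
exact: window_ge0.
Qed.

Lemma renewal_conv_window eta d mu t : 0 <= eta -> 0 <= d -> M mu ->
  (eta * renewal_window d mu t)%:E
  = renewal_conv mu (fun x => eta * window d x) t.
Proof.
move=> eta0 d0 Mmu; rewrite EFinM renewal_windowK// /renewal_conv.
rewrite -ge0_integralZl_EFin//.
- by move=> x _; rewrite lee_fin window_ge0.
- apply/measurable_EFinP; apply: measurable_fun_reflect.
  exact: measurable_window.
Qed.

Lemma smoothed_stepE d eta mu t : 0 <= d -> 0 <= eta -> M mu ->
  (smoothed_step d eta mu t)%:E
  = renewal_conv mu (clamp_increment d eta) (t - eta).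
Proof.
move=> d0 eta0 Mmu.
rewrite -(smoothed_increment (M_positive Mmu) m0 d0 (M_m Mmu))//.
by rewrite subrK.
Qed.

(** Together with [step_le_renewal_window]: the indicator of an interval lies
    between two trapezoids whose sides have width [eta]. *)
Lemma renewal_window_le_step d eta mu t : 0 <= d -> 0 < eta -> M mu ->
  renewal_window d mu t <= smoothed_step (d + eta) eta mu (t + eta) / eta.
Proof.
move=> d0 eta0 Mmu; have de : 0 <= d + eta by rewrite addr_ge0// ltW.
rewrite ler_pdivlMr// mulrC -lee_fin.
rewrite renewal_conv_window ?smoothed_stepE ?(ltW eta0)//.
rewrite addrK; apply: ge0_le_integral => //.
- by move=> x _; rewrite lee_fin mulr_ge0 ?window_ge0// ltW.
- apply/measurable_EFinP.
  apply: (@measurable_fun_reflect _ (fun x => eta * window d x)).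
  by apply: measurable_funM; [exact: measurable_cst|exact: measurable_window].
- by apply/measurable_EFinP; apply: measurable_fun_reflect;
    exact: measurable_clamp_increment.
- move=> s _; rewrite lee_fin; move: (t - s) => x.
  rewrite /window; case: ifP => [/andP[x0 xd]|_]; last first.
    by rewrite mulr0 clamp_increment_ge0// ltW.
  rewrite mulr1 /clamp_increment.
  by case: clampP => // *; case: clampP => // *; lra.
Qed.

Lemma step_le_renewal_window d eta mu t : eta <= d -> 0 < eta -> M mu ->
  smoothed_step (d - eta) eta mu t / eta <= renewal_window d mu t.
Proof.
move=> ed eta0 Mmu; have de : 0 <= d - eta by rewrite subr_ge0.
have d0 : 0 <= d by rewrite (le_trans _ ed)// ltW.
rewrite ler_pdivrMr// mulrC -lee_fin.
rewrite renewal_conv_window ?smoothed_stepE ?(ltW eta0)//.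
apply: ge0_le_integral => //.
- by move=> x _; rewrite lee_fin clamp_increment_ge0// ltW.
- by apply/measurable_EFinP; apply: measurable_fun_reflect;
    exact: measurable_clamp_increment.
- apply/measurable_EFinP.
  apply: (@measurable_fun_reflect _ (fun x => eta * window d x)).
  by apply: measurable_funM; [exact: measurable_cst|exact: measurable_window].
- move=> s _; rewrite lee_fin addrAC; move: (t - s) => x.
  rewrite /window; case: ifP => [_|/negbT].
    rewrite mulr1 (le_trans (clamp_increment_le _ de _)) ?(ltW eta0)//.
    by rewrite ge_min lexx.
  rewrite negb_and -!ltNge -leNgt mulr0 /clamp_increment subrK => /orP[] ?;
    by case: clampP => // *; case: clampP => // *; lra.
Qed.

Lemma smoothed_lip_le (d d' : R) : 0 <= d -> d <= d' ->
  smoothed_lip m d <= smoothed_lip m d'.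
Proof. by move=> d0 dd; rewrite /smoothed_lip ler_pM2r ?invr_gt0//; nra. Qed.

(** For large [t] both trapezoidal bounds are within a multiple of [eta] of
    [renewal_rate mu * d], and [eta] is arbitrary. As [eta <= 1], one constant
    [smoothed_lip m (d + 1)] serves for both. *)
Lemma blackwell d e : 0 < d -> 0 < e ->
  \forall t \near +oo, forall mu, M mu ->
    `|renewal_window d mu t - renewal_rate mu * d| <= e.
Proof.
move=> d0 e0; set C := smoothed_lip m (d + 1).
have d10 : 0 <= d + 1 by lra.
have C0 : 0 <= C by exact: smoothed_lip_ge0.
pose eta := Num.min (Num.min 1 d) (e * m / 2 / (1 + 2 * C)).
have eta0 : 0 < eta by rewrite !lt_min ltr01 d0/= !divr_gt0 ?mulr_gt0//; lra.
have eta1 : eta <= 1 by rewrite /eta !ge_min lexx.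
have etad : eta <= d by rewrite /eta !ge_min lexx orbT.
have etae : eta * (1 + 2 * C) <= e * m / 2.
  by rewrite -ler_pdivlMr; [rewrite ge_min lexx orbT|lra].
have e1 : 0 < e * m / 2 by rewrite divr_gt0// mulr_gt0.
have dm : 0 <= d - eta by lra.
have dp : 0 <= d + eta by lra.
have low := smoothed_slope dm eta0 e1.
have high := smoothed_slope dp eta0 e1.
have {}high : \forall t \near +oo, forall mu, M mu ->
    `|smoothed_step (d + eta) eta mu (t + eta) / eta
      - renewal_rate mu * (d + eta)|
      <= (2 * smoothed_lip m (d + eta) * eta + e * m / 2) / m.
  case: high => T [Treal HT]; exists T; split=> // t Tt; apply: HT.
  by rewrite (lt_le_trans Tt)// lerDl ltW.
apply: filterS2 low high => t low high mu Mmu.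
have [a a1 tail] := M_tail ltr01.
have a0 : 0 <= a by lra.
have r0 := renewal_rate_gt0 (M_positive Mmu) m0 (M_m Mmu) a0 (tail _ Mmu).
have rle := renewal_rate_le (M_positive Mmu) m0 (M_m Mmu) a0 (tail _ Mmu).
have w1 := renewal_window_le_step t (ltW d0) eta0 Mmu.
have w2 := step_le_renewal_window t etad eta0 Mmu.
have bound d' : 0 <= d' -> d' <= d + 1 ->
    renewal_rate mu * eta + (2 * smoothed_lip m d' * eta + e * m / 2) / m <= e.
  move=> d'0 d'1.
  have lC : smoothed_lip m d' <= C by exact: smoothed_lip_le.
  apply: (@le_trans _ _ ((eta + (2 * C * eta + e * m / 2)) / m)).
    rewrite [leRHS]mulrDl lerD//.
      by rewrite [leRHS]mulrC ler_wpM2r// ltW.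
    by rewrite ler_pM2r ?invr_gt0// lerD2r ler_wpM2r ?ler_wpM2l// ltW.
  by rewrite ler_pdivrMr//; lra.
have b1 := bound _ dp; have b2 := bound _ dm.
move: (low _ Mmu) (high _ Mmu); rewrite !ler_norml => /andP[l1 l2] /andP[h1 h2].
have {}b1 := b1 ltac:(lra); have {}b2 := b2 ltac:(lra).
move: l1 l2 h1 h2; rewrite !mulrBr !mulrDr => l1 l2 h1 h2.
by apply/andP; split; lra.
Qed.

End blackwell.

(** * Approximation by step functions *)

Section cell_bounds.
Context (R : realType).
Implicit Types (h : R -> R) (B a b d x y : R).

Definition cell_sup h a b : R := fine (esup_on `[a, b[ h).
Definition cell_inf h a b : R := fine (einf_on `[a, b[ h).

Variant cell_spec h B a b : Prop :=
  CellSpec of esup_on `[a, b[ h = (cell_sup h a b)%:E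
    & einf_on `[a, b[ h = (cell_inf h a b)%:E
    & (forall y, a <= y < b -> cell_inf h a b <= h y <= cell_sup h a b)
    & - B <= cell_inf h a b & cell_sup h a b <= B.

Lemma cellP h B a b : 0 <= a -> a < b -> (forall y, 0 <= y -> `|h y| <= B) ->
  cell_spec h B a b.
Proof.
move=> a0 ab hB.
have hB' y : a <= y < b -> - B <= h y <= B.
  by move=> /andP[ay _]; rewrite -ler_norml hB// (le_trans a0).
have aab : `[a, b[%classic a by rewrite /= in_itv/= lexx ab.
have [ha1 ha2] : - B <= h a /\ h a <= B.
  by apply/andP; apply: hB'; rewrite lexx ab.
have s1 : (esup_on `[a, b[ h <= B%:E)%E.
  apply: ge_ereal_sup => _ [y + <-]; rewrite /= in_itv/= lee_fin => yab.
  by have /andP[] := hB' _ yab.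
have s2 y : a <= y < b -> ((h y)%:E <= esup_on `[a, b[ h)%E.
  by move=> yab; apply: ereal_sup_ubound; exists y.
have i1 : ((- B)%:E <= einf_on `[a, b[ h)%E.
  apply: le_ereal_inf_tmp => _ [y + <-]; rewrite /= in_itv/= lee_fin => yab.
  by have /andP[] := hB' _ yab.
have i2 y : a <= y < b -> (einf_on `[a, b[ h <= (h y)%:E)%E.
  by move=> yab; apply: ereal_inf_lbound; exists y.
have aab' : a <= a < b by rewrite lexx ab.
have sE : esup_on `[a, b[ h = (cell_sup h a b)%:E.
  rewrite fineK// fin_numE -ltNye -ltey (lt_le_trans _ (s2 _ aab')) ?ltNyr//.
  exact: le_lt_trans s1 (ltry _).
have iE : einf_on `[a, b[ h = (cell_inf h a b)%:E.
  rewrite fineK// fin_numE -ltNye -ltey (lt_le_trans _ i1) ?ltNyr//=.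
  exact: le_lt_trans (i2 _ aab') (ltry _).
split => //.
- by move=> y yab; rewrite -!lee_fin -sE -iE i2// s2.
- by rewrite -lee_fin -iE.
- by rewrite -lee_fin -sE.
Qed.

Lemma windowB d x (n : nat) : 0 < d -> 0 <= x ->
  window d (x - n%:R * d) = (n == Num.truncn (x / d))%:R.
Proof.
move=> d0 x0; rewrite /window subr_ge0 ltrBlDr.
have xd0 : 0 <= x / d by rewrite divr_ge0// ltW.
have -> : (n%:R * d <= x) && (x < d + n%:R * d) = (n == Num.truncn (x / d)).
  have -> : d + n%:R * d = n.+1%:R * d by rewrite -natr1 mulrDl mul1r addrC.
  rewrite -ler_pdivlMr// -ltr_pdivrMr//.
  by rewrite eq_sym truncn_eq.
by case: ifP.
Qed.

Lemma sum_window d x (c : nat -> R) (K : nat) : 0 < d -> 0 <= x ->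
  \sum_(n < K) c n * window d (x - n%:R * d) =
  if (Num.truncn (x / d) < K)%N then c (Num.truncn (x / d)) else 0.
Proof.
move=> d0 x0; under eq_bigr do rewrite windowB//.
case: ifPn => [kK|kK].
  rewrite (bigD1 (Ordinal kK))//= eqxx mulr1 big1 ?addr0// => i ik.
  by rewrite (_ : (_ == _) = false) ?mulr0//; apply/negbTE.
rewrite big1// => i _; rewrite (_ : (_ == _) = false) ?mulr0//.
by apply/negbTE; apply: contra kK => /eqP <-.
Qed.

End cell_bounds.

(** One estimate serves both sides of the theorem: with [nu] the renewal
    measure and [phi s = t - s] it approximates the renewal convolution, with
    [nu] the Lebesgue measure and [phi] the identity it approximates the
    integral of [h]. The arguments below [N] are cut into [K] cells of length
    [d], the others are treated by the summability of the suprema over unit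
    cells. *)
Section step_approximation.
Context (R : realType) (nu : {measure set (measurableTypeR R) -> \bar R}).
Variables (D : set (measurableTypeR R)) (phi : measurableTypeR R -> R).
Hypothesis mD : measurable D.
Hypothesis mphi : measurable_fun D (phi : _ -> measurableTypeR R).
Hypothesis phi_ge0 : forall x, D x -> 0 <= phi x.
Variables (h : R -> R) (B : R).
Hypothesis mh : @measurable_fun _ _ (measurableTypeR R) (measurableTypeR R)
  `[0, +oo[%classic h.
Hypothesis hB : forall y, 0 <= y -> `|h y| <= B.
Variables (d : R) (K N : nat) (W : nat -> R) (A S : R).
Hypotheses (d0 : 0 < d) (KN : K%:R * d = N%:R) (A0 : 0 <= A).
Hypothesis W_E : forall n, (n < K)%N ->
  (\int[nu]_(x in D) (window d (phi x - n%:R * d))%:E = (W n)%:E)%E.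
Hypothesis A_bound : forall n, (N <= n)%N ->
  (\int[nu]_(x in D) (window 1 (phi x - n%:R))%:E <= A%:E)%E.
Hypothesis S_bound :
  (\sum_(N <= n <oo) esup_on `[n%:R, n.+1%:R[ (fun x => `|h x|%R)
    <= S%:E)%E.

Lemma Rintegral_sum (F : 'I_K -> measurableTypeR R -> R) :
  (forall i, nu.-integrable D (EFin \o F i)) ->
  \int[nu]_(x in D) (\sum_(i < K) F i x) =
  \sum_(i < K) \int[nu]_(x in D) F i x.
Proof.
move=> intF; rewrite {1}/Rintegral.
under eq_integral do rewrite -sumEFin.
rewrite (integral_sum mD (f := fun i => EFin \o F i))//.
under eq_bigr => i _ do rewrite -(fineK (integrable_fin_num mD (intF i))).
by rewrite sumEFin.
Qed.

Let win n x := window d (phi x - n%:R * d).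

Lemma measurable_window_shift e (c : R) :
  measurable_fun D ((fun x => window e (phi x - c)) : _ -> measurableTypeR R).
Proof.
apply: (measurableT_comp (@measurable_window R e)).
by apply: measurable_funB => //; exact: measurable_cst.
Qed.

Lemma integrable_win n : (n < K)%N -> nu.-integrable D (EFin \o win n).
Proof.
move=> nK; apply/integrableP; split.
  by apply/measurable_EFinP; exact: measurable_window_shift.
under eq_integral => x _ do rewrite /= ger0_norm ?window_ge0//.
by rewrite W_E// ltry.
Qed.

Lemma integrable_scaled_win n (c : R) : (n < K)%N ->
  nu.-integrable D (EFin \o (fun x => c * win n x)).
Proof. by move=> nK; exact: (integrableZl mD c (integrable_win nK)). Qed.

Lemma integrable_step (c : nat -> R) :
  nu.-integrable D (EFin \o (fun x => \sum_(n < K) c n * win n x)).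
Proof.
have := @integrable_sum _ _ _ nu D mD _ (index_enum 'I_K) xpredT
  (fun n => EFin \o (fun x => c n * win n x))
  (fun i _ => integrable_scaled_win (c i) (ltn_ord i)).
by apply: eq_integrable => // x _; rewrite /= sumEFin.
Qed.

Lemma Rintegral_step (c : nat -> R) :
  \int[nu]_(x in D) (\sum_(n < K) c n * win n x) = \sum_(n < K) c n * W n.
Proof.
rewrite Rintegral_sum => [|i]; last exact: integrable_scaled_win.
apply: eq_bigr => i _; rewrite RintegralZl//; last exact: integrable_win.
by congr (_ * _); rewrite /Rintegral W_E.
Qed.

Let cell x := Num.truncn (phi x / d).

Lemma cell_lt x : D x -> (cell x < K)%N = (phi x < N%:R).
Proof.
move=> Dx; have x0 := phi_ge0 Dx.
have xd0 : 0 <= phi x / d by rewrite divr_ge0// ltW.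
have /andP[t1 t2] := truncn_itv xd0.
rewrite -KN -ltr_pdivrMr//; apply/idP/idP => [cK|xK].
  by apply: lt_le_trans t2 _; rewrite ler_nat.
by rewrite -(@ltr_nat R); exact: le_lt_trans t1 xK.
Qed.

Lemma cell_itv x : D x ->
  (cell x)%:R * d <= phi x < (cell x)%:R * d + d.
Proof.
move=> Dx; have x0 := phi_ge0 Dx.
have xd0 : 0 <= phi x / d by rewrite divr_ge0// ltW.
have /andP[t1 t2] := truncn_itv xd0.
rewrite -ler_pdivlMr// t1/= -{2}[d]mul1r -mulrDl natr1.
by rewrite -ltr_pdivrMr.
Qed.

Lemma measurable_composite :
  measurable_fun D ((h \o phi) : _ -> measurableTypeR R).
Proof.
apply: (measurable_comp _ _ mh mphi); first exact: measurable_itv.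
by move=> _ [x Dx <-]; rewrite /= in_itv/= andbT phi_ge0.
Qed.

(** The absolute value of [h \o phi] where [phi] is at least [N], written so
    that its measurability is clear. *)
Let tail x : R := `|h (phi x)| * (1 - \sum_(n < K) 1 * win n x).

Lemma tailE x : D x -> tail x = if phi x < N%:R then 0 else `|h (phi x)|.
Proof.
move=> Dx; rewrite /tail /win (@sum_window _ d (phi x) (fun=> 1)) ?phi_ge0//.
rewrite -/(cell x) cell_lt//.
by case: ifP; rewrite ?subrr ?mulr0// subr0 mulr1.
Qed.

Lemma tail_ge0 x : D x -> 0 <= tail x.
Proof. by move=> Dx; rewrite tailE//; case: ifP. Qed.

Lemma measurable_tail : measurable_fun D (tail : _ -> measurableTypeR R).
Proof.
apply: measurable_funM.
  by apply: measurableT_comp => //; exact: measurable_composite.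
apply: measurable_funB; first exact: measurable_cst.
apply: measurable_sum => n.
apply: measurable_funM; first exact: measurable_cst.
exact: measurable_window_shift.
Qed.

Lemma unit_cell_sup_ge0 n :
  (0 <= esup_on `[n%:R, n.+1%:R[ (fun x => `|h x|%R))%E.
Proof.
apply: (@le_trans _ _ (`|h n%:R|)%:E); first by rewrite lee_fin.
apply: ereal_sup_ubound; exists n%:R => //.
by rewrite /= in_itv/= lexx/= ltr_nat ltnSn.
Qed.

(** Every unit cell beyond [N] has mass at most [A], and the suprema of [`|h|]
    over these cells sum up to at most [S]. *)
Lemma integral_tail : (\int[nu]_(x in D) (tail x)%:E <= (A * S)%:E)%E.
Proof.
pose s n := esup_on `[n%:R, n.+1%:R[ (fun x => `|h x|%R).
have s0 n : (0 <= s n)%E := unit_cell_sup_ge0 n.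
pose F n x := (s (n + N)%N * (window 1 (phi x - (n + N)%:R))%:E)%E.
have F0 n x : (0 <= F n x)%E by rewrite mule_ge0// lee_fin window_ge0.
have mF n : measurable_fun D (F n).
  apply: emeasurable_funM; first exact: measurable_cst.
  by apply/measurable_EFinP; exact: measurable_window_shift.
apply: (@le_trans _ _ (\int[nu]_(x in D) (\sum_(n <oo) F n x))%E).
  apply: ge0_le_integral => //.
  - by move=> x Dx; rewrite lee_fin tail_ge0.
  - by apply/measurable_EFinP; exact: measurable_tail.
  - by apply: ge0_emeasurable_sum.
  - move=> x Dx; rewrite tailE//; case: ifPn => [_|].
      by apply: nneseries_ge0.
    rewrite -leNgt => Nx; have x0 := phi_ge0 Dx.
    pose k := Num.truncn (phi x).
    have /andP[k1 k2] := truncn_itv x0; rewrite -/k in k1 k2.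
    have Nk : (N <= k)%N.
      by rewrite -ltnS -(@ltr_nat R); exact: le_lt_trans Nx k2.
    apply: (@le_trans _ _ (F (k - N)%N x)).
      rewrite /F subnK//.
      have -> : window 1 (phi x - k%:R) = 1.
        by rewrite -[k%:R]mulr1 windowB// divr1 eqxx.
      rewrite mule1; apply: ereal_sup_ubound; exists (phi x) => //=.
      by rewrite in_itv/= k1.
    apply: le_trans (nneseries_lim_ge (k - N).+1 _) => //.
    by rewrite big_nat_recr//= leeDr// sume_ge0.
rewrite integral_nneseries//.
apply: (@le_trans _ _ (\sum_(n <oo) (A%:E * s (n + N)%N))%E).
  apply: lee_nneseries => [n _ _|n _]; first by apply: integral_ge0 => x _.
  rewrite /F ge0_integralZl//; last 2 first.
  - by apply/measurable_EFinP; exact: measurable_window_shift.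
  - by move=> x _; rewrite lee_fin window_ge0.
  by rewrite muleC lee_wpmul2r// A_bound// leq_addl.
rewrite nneseriesZl// EFinM lee_wpmul2l ?lee_fin//.
by rewrite (nneseries_addn (f := s) N).
Qed.

Lemma integrable_tail : nu.-integrable D (EFin \o tail).
Proof.
apply/integrableP; split.
  by apply/measurable_EFinP; exact: measurable_tail.
apply: (@le_lt_trans _ _ (A * S)%:E); last exact: ltry.
apply: le_trans integral_tail; apply: ge0_le_integral => //.
- apply: measurableT_comp => //.
  by apply/measurable_EFinP; exact: measurable_tail.
- by apply/measurable_EFinP; exact: measurable_tail.
- by move=> x Dx; rewrite /= ger0_norm// tail_ge0.
Qed.

Lemma integrable_composite : nu.-integrable D (EFin \o (h \o phi)).
Proof.
have := integrableD mD (integrable_step (fun=> B)) integrable_tail.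
apply: le_integrable => //.
  by apply/measurable_EFinP; exact: measurable_composite.
move=> x Dx; rewrite /= lee_fin.
rewrite (@sum_window _ d (phi x) (fun=> B)) ?phi_ge0//.
rewrite -/(cell x) cell_lt// tailE//.
case: ifP => xN; last by rewrite add0r normr_id.
by rewrite addr0 (le_trans (hB (phi_ge0 Dx)))// ler_norm.
Qed.

Let csup n := cell_sup h (n%:R * d) (n%:R * d + d).
Let cinf n := cell_inf h (n%:R * d) (n%:R * d + d).

Lemma step_approximation :
  `|\int[nu]_(x in D) h (phi x) - \sum_(n < K) csup n * W n|
  <= \sum_(n < K) (csup n - cinf n) * W n + A * S.
Proof.
have iD : nu.-integrable D
    (EFin \o (fun x => h (phi x) - \sum_(n < K) csup n * win n x)).
  exact: (integrableB mD integrable_composite (integrable_step csup)).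
have iE : nu.-integrable D
    (EFin \o (fun x => \sum_(n < K) (csup n - cinf n) * win n x + tail x)).
  exact: (integrableD mD (integrable_step (fun n => csup n - cinf n))
            integrable_tail).
have -> : \int[nu]_(x in D) h (phi x) - \sum_(n < K) csup n * W n =
    \int[nu]_(x in D) (h (phi x) - \sum_(n < K) csup n * win n x).
  rewrite RintegralB ?Rintegral_step//; first exact: integrable_composite.
  exact: integrable_step.
apply: le_trans (le_normr_Rintegral mD iD) _.
apply: (@le_trans _ _ (\int[nu]_(x in D)
    (\sum_(n < K) (csup n - cinf n) * win n x + tail x))).
  apply: le_Rintegral => //; first exact: integrable_norm.
  move=> x Dx; rewrite (@sum_window _ d (phi x) csup) ?phi_ge0//.
  rewrite (@sum_window _ d (phi x) (fun n => csup n - cinf n)) ?phi_ge0//.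
  rewrite -/(cell x) tailE// cell_lt//.
  case: ifP => xN; last by rewrite subr0 add0r.
  rewrite addr0; have [c0 cd] : 0 <= (cell x)%:R * d /\
      (cell x)%:R * d < (cell x)%:R * d + d.
    by split; [rewrite mulr_ge0// ltW|rewrite ltrDl].
  have [_ _ hc _ _] := cellP c0 cd hB.
  have /andP[h1 h2] := hc _ (cell_itv Dx).
  by rewrite ler0_norm ?subr_le0// opprB lerB.
rewrite RintegralD//; last 2 first.
- exact: (integrable_step (fun n => csup n - cinf n)).
- exact: integrable_tail.
rewrite (Rintegral_step (fun n => csup n - cinf n)) lerD2l -lee_fin fineK.
  exact: integral_tail.
exact: (integrable_fin_num mD integrable_tail).
Qed.

End step_approximation.

(** * The key renewal theorem *)

Section direct_Riemann_integrability.
Context (R : realType) (H : set (R -> R)).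

Lemma dRi_bounded : uniformly_dRi H ->
  exists2 B, 0 <= B & forall h y, H h -> 0 <= y -> `|h y| <= B.
Proof.
case => + _ _; set S := ereal_sup _ => Soo.
exists `|fine S| => // h y Hh y0.
have /andP[k1 k2] := truncn_itv y0; set k := Num.truncn y in k1 k2.
pose s n := esup_on `[n%:R, n.+1%:R[ (fun x => `|h x|%R).
have hs : (`|h y|%:E <= s k)%E.
  by apply: ereal_sup_ubound; exists y => //=; rewrite in_itv/= k1.
have sS : (s k <= S)%E.
  apply: (@le_trans _ _ (\sum_(0 <= n <oo) s n)%E); last first.
    by apply: ereal_sup_ubound; exists h.
  have s0 n : (0 <= s n)%E := unit_cell_sup_ge0 h n.
  apply: le_trans (nneseries_lim_ge k.+1 _) => //.
  by rewrite big_nat_recr//= leeDr// sume_ge0.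
have hS := le_trans hs sS.
have S0 : (0 <= S)%E by apply: le_trans hS; rewrite lee_fin.
rewrite -lee_fin (le_trans hS)// -{1}(@fineK _ S) ?lee_fin ?ler_norm//.
by rewrite ge0_fin_numE.
Qed.

Lemma dRi_small_cells e : uniformly_dRi H -> 0 < e ->
  exists k : nat, let d := k.+1%:R^-1 in forall h, H h ->
    (d%:E * \sum_(0 <= n <oo)
       (esup_on `[(n%:R * d)%R, (n%:R * d + d)%R[ h
        - einf_on `[(n%:R * d)%R, (n%:R * d + d)%R[ h) < e%:E)%E.
Proof.
case=> _ _ /(_ e) + e0 => /(_ e0) /nbhs_ballP[r r0 Hr].
exists (Num.truncn r^-1); apply: Hr.
  rewrite /ball/= sub0r normrN gtr0_norm ?invr_gt0//.
  by rewrite -[ltRHS]invrK ltf_pV2 ?posrE ?invr_gt0// truncnS_gt.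
by rewrite invr_gt0.
Qed.

End direct_Riemann_integrability.

Section windows.
Context (R : realType).

Lemma lebesgue_window (c d : R) : 0 <= c -> 0 < d ->
  (\int[lebesgue_measure]_(x in `[0%R, +oo[) (window d (x - c))%:E = d%:E)%E.
Proof.
move=> c0 d0.
have wE (x : R) : window d (x - c) = \1_(`[c, c + d[%classic : set R) x.
  rewrite /window indicE mem_setE in_itv/= subr_ge0 ltrBlDl.
  by case: ifP.
under eq_integral do rewrite wE.
rewrite integral_indic//.
have -> : `[c, (c + d)%R[ `&` `[0%R, +oo[ = `[c, (c + d)%R[%classic.
  apply/setIidl => x /=; rewrite !in_itv/= andbT => /andP[cx _].
  exact: le_trans cx.
apply: etrans (lebesgue_measure_itv `[c, c + d[) _.
by rewrite /= lte_fin ltrDl d0 -EFinB addrAC subrr add0r.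
Qed.

Lemma le_lebesgue_window (c d : R) : 0 <= c -> 0 < d ->
  (\int[lebesgue_measure]_(x in `[0%R, +oo[) (window d (x - c))%:E <= d%:E)%E.
Proof. by move=> c0 d0; rewrite lebesgue_window. Qed.

Section renewal.
Context (M : set (realProbability R)) (m : R).
Hypothesis M_positive : forall mu, M mu -> on_positive mu.
Hypotheses (m0 : 0 < m) (M_m : forall mu, M mu -> m <= truncated_mean mu).

(** Here [c + d <= t] ensures that the window stays within [[0, t]]. *)
Lemma renewal_window_restrict mu (t c d : R) : M mu -> 0 <= c -> 0 <= d ->
  c + d <= t ->
  (\int[renewal_measure mu]_(s in `[0%R, t]) (window d (t - s - c))%:E
   = (renewal_window d mu (t - c))%:E)%E.
Proof.
move=> Mmu c0 d0 cdt; rewrite (renewal_windowK M_positive m0 M_m)//.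
rewrite integral_mkcond; apply: eq_integral => s _.
rewrite patchE mem_setE in_itv/= addrAC.
case: ifPn => //; rewrite negb_and -!ltNge => st; congr EFin.
rewrite /window; case: ifP => // /andP[h1 h2].
by case/orP: st => ?; lra.
Qed.

Lemma renewal_window_restrict_le mu (t c : R) : M mu ->
  (\int[renewal_measure mu]_(s in `[0%R, t]) (window 1 (t - s - c))%:E
   <= (2 / m)%:E)%E.
Proof.
move=> Mmu.
apply: le_trans (renewal_window_bound M_positive m0 M_m (t - c) ler01 Mmu).
rewrite /renewal_conv; under eq_integral do rewrite addrAC.
apply: ge0_subset_integral => //.
- apply/measurable_EFinP; apply: measurable_fun_reflect.
  exact: measurable_window.
- by move=> s _; rewrite lee_fin window_ge0.
Qed.

End renewal.

End windows.

Section key_renewal.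
Context (R : realType) (M : set (realProbability R)) (m : R).
Hypothesis M_positive : forall mu, M mu -> on_positive mu.
Hypotheses (m0 : 0 < m) (M_m : forall mu, M mu -> m <= truncated_mean mu).

(** The two step approximations have the same coefficients, and their weights
    [renewal_window d mu (t - n * d)] and [renewal_rate mu * d] are
    [eps]-close. Of the final bound, [o] comes from the oscillation inside
    the cells, [S] from the arguments beyond [N]. *)
Lemma key_renewal_estimate mu (h : R -> R) (B d t S o eps : R) (K N : nat) :
  M mu -> 0 <= renewal_rate mu <= m^-1 ->
  @measurable_fun _ _ (measurableTypeR R) (measurableTypeR R)
    `[0, +oo[%classic h ->
  (forall y, 0 <= y -> `|h y| <= B) -> 0 < d -> K%:R * d = N%:R ->
  N%:R <= t -> 0 <= S -> 0 <= eps ->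
  (\sum_(N <= n <oo) esup_on `[n%:R, n.+1%:R[ (fun x => `|h x|%R)
     <= S%:E)%E ->
  \sum_(n < K) (cell_sup h (n%:R * d) (n%:R * d + d)
    - cell_inf h (n%:R * d) (n%:R * d + d)) * d <= o ->
  (forall n, (n < K)%N ->
    `|renewal_window d mu (t - n%:R * d) - renewal_rate mu * d| <= eps) ->
  `|renewal_convolution mu h t
    - renewal_rate mu * \int[lebesgue_measure]_(s in `[0, +oo[) h s|
  <= 2 * o / m + 3 * S / m + 3 * K%:R * B * eps.
Proof.
move=> Mmu /andP[r0 rm] mh hB d0 KN Nt S0 eps0 hS hosc hW.
set csup := (fun n : nat => cell_sup h (n%:R * d) (n%:R * d + d)).
set cinf := (fun n : nat => cell_inf h (n%:R * d) (n%:R * d + d)).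
set r := renewal_rate mu in r0 rm hW *.
pose W (n : nat) := renewal_window d mu (t - n%:R * d).
have cell_n n : cell_spec h B (n%:R * d) (n%:R * d + d).
  by apply: cellP => //; [rewrite mulr_ge0// ltW|rewrite ltrDl].
have cB n : `|csup n| <= B /\ 0 <= csup n - cinf n <= 2 * B.
  have [_ _ hc iB sB] := cell_n n.
  have nd : n%:R * d <= n%:R * d < n%:R * d + d by rewrite lexx ltrDl.
  have /andP[h1 h2] := hc _ nd; rewrite -/(csup n) -/(cinf n) in h1 h2 iB sB.
  by split; [rewrite ler_norml; apply/andP; split; lra|apply/andP; split; lra].
have B0 : 0 <= B by have [+ _] := cB 0%N; exact: le_trans.
have m2 : 0 <= 2 / m by rewrite divr_ge0// ltW.
have nd_t n : (n < K)%N -> n%:R * d + d <= t.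
  move=> nK; apply: le_trans Nt; rewrite -KN -{2}[d]mul1r -mulrDl natr1.
  by rewrite ler_pM2r// ler_nat.
have appU : `|renewal_convolution mu h t - \sum_(n < K) csup n * W n|
    <= \sum_(n < K) (csup n - cinf n) * W n + 2 / m * S.
  apply: (@step_approximation R (renewal_measure mu) `[0, t]%classic
    (fun s => t - s) _ _ _ h B mh hB d K N W (2 / m) S) => //.
  - exact: measurable_funB.
  - by move=> s; rewrite /= in_itv/= subr_ge0 => /andP[].
  - move=> n nK; apply: (renewal_window_restrict M_positive m0 M_m) => //.
    + by rewrite mulr_ge0// ltW.
    + exact: ltW.
    + exact: nd_t.
  - by move=> n _; exact: (renewal_window_restrict_le M_positive m0 M_m).
have appL : `|\int[lebesgue_measure]_(s in `[0, +oo[) h s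
      - \sum_(n < K) csup n * d|
    <= \sum_(n < K) (csup n - cinf n) * d + 1 * S.
  apply: (@step_approximation R lebesgue_measure `[0, +oo[%classic
    (fun s => s) _ _ _ h B mh hB d K N (fun=> d) 1 S) => //.
  - by move=> s; rewrite /= in_itv/= andbT.
  - by move=> n nK; apply: lebesgue_window => //; rewrite mulr_ge0// ltW.
  - by move=> n _; exact: le_lebesgue_window.
have sumW : \sum_(n < K) (csup n - cinf n) * W n
    <= r * o + K%:R * (2 * B * eps).
  apply: (@le_trans _ _
    (\sum_(n < K) (r * ((csup n - cinf n) * d) + 2 * B * eps))).
    apply: ler_sum => n _; have [_ /andP[c0 c2]] := cB n.
    have := hW n (ltn_ord n); rewrite -/(W n) ler_norml => /andP[_ w2].
    have h1 : (csup n - cinf n) * W n <= (csup n - cinf n) * (r * d + eps).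
      by rewrite ler_wpM2l//; lra.
    have h2 : (csup n - cinf n) * eps <= 2 * B * eps by rewrite ler_wpM2r.
    by rewrite mulrDr in h1; rewrite mulrCA; lra.
  rewrite big_split/= -mulr_sumr sumr_const card_ord -[X in _ + X]mulr_natl.
  by rewrite lerD2r ler_wpM2l.
have sumC : `|\sum_(n < K) csup n * W n - r * \sum_(n < K) csup n * d|
    <= K%:R * (B * eps).
  rewrite mulr_sumr -sumrB; apply: le_trans (ler_norm_sum _ _ _) _.
  apply: (@le_trans _ _ (\sum_(n < K) B * eps)).
    apply: ler_sum => n _; have [cn _] := cB n.
    rewrite mulrCA -mulrBr normrM ler_pM//.
    exact: hW (ltn_ord n).
  by rewrite sumr_const card_ord -[leLHS]mulr_natl.
have o0 : 0 <= o.
  apply: le_trans hosc; apply: sumr_ge0 => n _.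
  by have [_ /andP[c0 _]] := cB n; rewrite mulr_ge0// ltW.
have ro : r * o <= o / m by rewrite mulrC ler_wpM2l.
have rL : r * `|\int[lebesgue_measure]_(s in `[0, +oo[) h s
      - \sum_(n < K) csup n * d| <= (o + S) / m.
  rewrite [leRHS]mulrC; apply: ler_pM => //.
  by apply: le_trans appL _; rewrite mul1r lerD2r.
rewrite -[r in r * `|_|]ger0_norm// -normrM mulrBr in rL.
move: appU sumC rL.
set X := renewal_convolution _ _ _; set Y := _ * Rintegral _ _ _.
set Z := \sum_(n < K) csup n * W n; set V := r * _.
rewrite !ler_norml => /andP[a1 a2] /andP[b1 b2] /andP[c1 c2].
have e1 : (o + S) / m = o / m + S / m by rewrite mulrDl.
have e2 : 2 / m * S = 2 * (S / m) by ring.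
have e3 : 2 * o / m = 2 * (o / m) by rewrite mulrA.
have e4 : 3 * S / m = 3 * (S / m) by rewrite mulrA.
have e5 : K%:R * (2 * B * eps) = 2 * (K%:R * B * eps) by ring.
have e6 : K%:R * (B * eps) = K%:R * B * eps by ring.
have e7 : 3 * K%:R * B * eps = 3 * (K%:R * B * eps) by ring.
rewrite e3 e4 e7; rewrite e1 in c1 c2; rewrite e2 in a1 a2.
rewrite e5 in sumW; rewrite e6 in b1 b2.
by apply/andP; split; lra.
Qed.

End key_renewal.

Theorem theorem1p11 (R : realType) (M : set (realProbability R))
    (H : set (R -> R))
    (M_positive : forall mu, M mu -> on_positive mu)
    (M_compact : weakly_compact M)
    (M_span : forall mu, M mu -> Span mu = 0)
    (M_ui : uniformly_integrable M)
    (H_measurable : forall h : R -> R, H h ->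
      @measurable_fun _ _ (measurableTypeR R) (measurableTypeR R)
        `[0, +oo[%classic h)
    (H_dRi : uniformly_dRi H) :
  forall e : R, 0 < e -> \forall t \near +oo, forall mu h, M mu -> H h ->
    `|renewal_convolution mu h t
      - renewal_rate mu * \int[lebesgue_measure]_(s in `[0, +oo[) h s| < e.
Proof.
move=> e e0.
have [m m0 M_m] := truncated_mean_bounded_below M_positive M_compact.
have M_tail e' : 0 < e' ->
    exists2 a, 1 <= a & forall mu, M mu -> tail_small mu a e'.
  exact: uniformly_integrable_tail.
have [B B0 hB] := dRi_bounded H_dRi.
(* Each of the three terms of [key_renewal_estimate] becomes at most [e / 4]. *)
pose o := e * m / 8; pose S := e * m / 12.
have o0 : 0 < o by rewrite divr_gt0// mulr_gt0.
have S0 : 0 < S by rewrite divr_gt0// mulr_gt0.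
have [k] := dRi_small_cells H_dRi o0; set d := k.+1%:R^-1 => hk.
have d0 : 0 < d by rewrite invr_gt0.
have [N hN] : exists N : nat, forall h, H h ->
    (\sum_(N <= n <oo) esup_on `[n%:R, n.+1%:R[ (fun x => `|h x|%R) < S%:E)%E.
  by have [_ /(_ S S0) + _] := H_dRi; exact: filter_ex.
pose K := (N * k.+1)%N.
have KN : K%:R * d = N%:R by rewrite natrM mulfK// pnatr_eq0.
pose eps := e / 4 / (3 * (K%:R * B + 1)).
have KB0 : 0 <= K%:R * B by rewrite mulr_ge0.
have eps0 : 0 < eps by rewrite !divr_gt0//; lra.
have [T [Treal HT]] :=
  blackwell M_positive m0 M_m M_tail M_compact M_span d0 eps0.
have [a a1 tail] := M_tail _ (ltr01 : 0 < 1 :> R).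
have a0 : 0 <= a by lra.
exists (Num.max (T + N%:R) N%:R); split; first exact: num_real.
move=> t; rewrite gt_max => /andP[Tt Nt] mu h Mmu Hh.
have rgt0 := renewal_rate_gt0 (M_positive _ Mmu) m0 (M_m _ Mmu) a0 (tail _ Mmu).
have rle := renewal_rate_le (M_positive _ Mmu) m0 (M_m _ Mmu) a0 (tail _ Mmu).
apply: le_lt_trans (key_renewal_estimate (B := B) (d := d) (S := S) (o := o)
  (eps := eps) (K := K) (N := N) M_positive m0 M_m Mmu
  _ _ _ _ _ _ _ _ _ _ _) _ => //.
- by rewrite (ltW rgt0).
- exact: H_measurable.
- by move=> y; exact: hB.
- exact: ltW.
- exact: ltW.
- exact: ltW.
- by apply: ltW; exact: hN.
- have cells n : (esup_on `[(n%:R * d)%R, (n%:R * d + d)%R[ h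
      - einf_on `[(n%:R * d)%R, (n%:R * d + d)%R[ h)%E =
      (cell_sup h (n%:R * d) (n%:R * d + d)
       - cell_inf h (n%:R * d) (n%:R * d + d))%:E /\
      0 <= cell_sup h (n%:R * d) (n%:R * d + d)
       - cell_inf h (n%:R * d) (n%:R * d + d).
    have nd0 : 0 <= n%:R * d by rewrite mulr_ge0// ltW.
    have nd1 : n%:R * d < n%:R * d + d by rewrite ltrDl.
    have [-> -> hc _ _] := cellP nd0 nd1 (fun y => @hB h y Hh).
    split; first by rewrite EFinB.
    have := hc (n%:R * d); rewrite lexx nd1 => /(_ isT) /andP[h1 h2].
    by rewrite subr_ge0 (le_trans h1).
  rewrite -mulr_suml mulrC -lee_fin EFinM.
  apply: le_trans (ltW (hk _ Hh)); rewrite lee_wpmul2l ?lee_fin ?(ltW d0)//.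
  under eq_eseriesr do rewrite (cells _).1.
  apply: le_trans (nneseries_lim_ge K _); last first.
    by move=> n _ _; rewrite lee_fin (cells n).2.
  by rewrite big_mkord sumEFin.
- move=> n nK; apply: HT => //.
  have : n%:R * d <= N%:R by rewrite -KN ler_pM2r// ler_nat ltnW.
  lra.
have -> : 2 * o / m = e / 4 by rewrite /o; field; rewrite gt_eqF.
have -> : 3 * S / m = e / 4 by rewrite /S; field; rewrite gt_eqF.
have : 3 * K%:R * B * eps <= e / 4.
  have h1 : 0 < 3 * (K%:R * B + 1) by lra.
  rewrite /eps mulrA ler_pdivrMr// [leRHS]mulrC ler_wpM2r//; last by lra.
  by rewrite divr_ge0// ltW.
lra.
Qed.
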